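(* Let $F\in\mathcal L_n$ be a real function with $\|F\|_{\mathsf E}\le 1$. Then $F$ is an extremal function of the extremal problem (for $\mathsf E$, $D_n^\infty$, $x_*$) if and only if $F$ has a maximal alternation set, i.e. an alternation set consisting of $n+1$ points. Moreover, in that case $F$ is the unique extremal function.
   Context: Let $\mathsf E\subset\overline{\mathbb R}=\mathbb R\cup\{\infty\}$ be a compact proper subset containing infinitely many points; connected components of $\overline{\mathbb R}\setminus\mathsf E$ are called gaps. A sequence $(t_0,\dots,t_m)$, $m\ge2$, in $\overline{\mathbb R}$ is cyclically ordered if it has no repetitions and there is $f\in\mathrm{PSL}(2,\mathbb R)$ (orientation-preserving Möbius maps preserving $\overline{\mathbb R}$) with $f(t_0)=\infty$ and $f(t_1)<\dots<f(t_m)$. For distinct $a,b\in\overline{\mathbb R}$: $(a,b)=\{c:(a,c,b)\text{ cyclically ordered}\}$, $[a,b)=(a,b)\cup\{a\}$. A divisor is a finitely supported function $D:\overline{\mathbb C}\to\mathbb Z$; it is integral if $D\ge 0$, and $\deg D=\sum_z D(z)$. For a rational function $f$, $(f)_\infty$ denotes its polar divisor (order of each pole, including at $\infty$) and $(f)_0$ its zero divisor, with the convention $(f)_\infty=(f)_0=0$ for constant $f$. For integral $D$, $\mathcal L(D)=\{f\text{ rational}:(f)_\infty\le D\}$. For $\mathbf c\in\overline{\mathbb R}$ put $r(z,\mathbf c)=1/(\mathbf c-z)$ if $\mathbf c\ne\infty$ and $r(z,\infty)=z$. Fix $n\ge1$, an integral divisor $D_n^\infty$ of degree $n$ with support in $\overline{\mathbb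 R}\setminus\mathsf E$, and $x_*\in\overline{\mathbb R}\setminus\mathsf E$; let $d_n=D_n^\infty(x_* )$, $\mathcal L_n=\mathcal L(D_n^\infty)$, $\|F\|_{\mathsf E}=\sup_{\mathsf E}|F|$. The extremal problem is $$m_n(x_* )=\sup\Big\{\Re\lim_{x\to x_*}\frac{F(x)}{r(x,x_* )^{d_n}}: F\in\mathcal L_n,\ \|F\|_{\mathsf E}\le1\Big\},$$ and an extremal function is an $F$ attaining this supremum. A function $F$ is real if $F(\bar z)=\overline{F(z)}$. The sign function is $S_n(x)=\sum_{\mathbf c\in\overline{\mathbb R}\setminus\{x_*\}}D_n^\infty(\mathbf c)\chi_{[x_*,\mathbf c)}(x)$. For real $F\in\mathcal L_n$ with $\|F\|_{\mathsf E}\le 1$, an alternation set is a set of distinct points $x_1,\dots,x_m\in\mathsf E$ such that $(x_*,x_1,\dots,x_m)$ is cyclically ordered and $F(x_j)=(-1)^{m-j-S_n(x_j)}$ for $j=1,\dots,m$; it is maximal if $m=n+1$. *)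

(* Defs.v *)
From HB Require Import structures.
From mathcomp Require Import all_boot all_order all_algebra.
From mathcomp Require Import complex.
From mathcomp Require Import all_classical all_reals all_analysis.
Set Implicit Arguments.
Unset Strict Implicit.
Unset Printing Implicit Defensive.
Import Order.TTheory GRing.Theory Num.Theory.
Import numFieldNormedType.Exports.
Local Open Scope ring_scope.

(* The extended real line  Rbar = R u {oo}  is modelled by [option R]:
   [Some x] is the real number x and [None] is the point oo.
   Likewise the Riemann sphere  Cbar = C u {oo}  is [option R[i]]. *)

Definition embC (R : realType) (t : option R) : option R[i] :=
  omap (fun x : R => real_complex R x) t.
Arguments embC {R}.

(* Rbar carries the topology of the circle, transported by the inverse
   stereographic projection Rbar -> S^1 (a homeomorphism); a subset of Rbar
   is compact iff its image is a compact subset of R x R. *)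
Definition stereo (R : realType) (t : option R) : R * R :=
  match t with
  | Some x => (2 * x / (1 + x ^+ 2), (x ^+ 2 - 1) / (1 + x ^+ 2))
  | None => (0, 1)
  end.
Arguments stereo {R}.

Definition compact_Rbar (R : realType) (E : set (option R)) : Prop :=
  compact (stereo @` E).
Arguments compact_Rbar {R}.

Definition mobius (R : realType) (a b c d : R) (t : option R) : option R :=
  match t with
  | Some x => if c * x + d == 0 then None else Some ((a * x + b) / (c * x + d))
  | None => if c == 0 then None else Some (a / c)
  end.
Arguments mobius {R}.

Definition cyc_ordered (R : realType) (s : seq (option R)) : Prop :=
  match s with
  | [::] => False
  | t0 :: ts =>
      (2 <= size ts)%N /\ uniq s /\
      exists a b c d : R, a * d - b * c = 1 /\
        mobius a b c d t0 = None /\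
        exists ys : seq R, map (mobius a b c d) ts = map Some ys /\
                           sorted (fun x y : R => x < y) ys
  end.
Arguments cyc_ordered {R}.

Definition in_open (R : realType) (a b c : option R) : Prop :=
  cyc_ordered [:: a; c; b].
Arguments in_open {R}.
Definition in_halfopen (R : realType) (a b c : option R) : Prop :=
  in_open a b c \/ c = a.
Arguments in_halfopen {R}.

Record ratfun (R : realType) := RatFun {
  rnum : {poly R[i]};
  rden : {poly R[i]};
  rden_monic : rden \is monic;
  rfrac_coprime : coprimep rnum rden }.
Arguments rnum {R}.
Arguments rden {R}.

(* value at a finite point (junk value 0 at poles) *)
Definition feval (R : realType) (F : ratfun R) (z : R[i]) : R[i] :=
  (rnum F).[z] / (rden F).[z].
Arguments feval {R}.

(* value at a point of Rbar; at oo it is the limit value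
   (0 if deg P < deg Q, lead P / lead Q if deg P = deg Q; junk otherwise) *)
Definition feval_Rbar (R : realType) (F : ratfun R) (t : option R) : R[i] :=
  match t with
  | Some x => feval F (real_complex R x)
  | None => if (size (rnum F) < size (rden F))%N then 0
            else lead_coef (rnum F) / lead_coef (rden F)
  end.
Arguments feval_Rbar {R}.

(* order of the pole of F at a point of Cbar, i.e. the value of the polar
   divisor (F)_oo at that point (0 if not a pole). *)
Definition poleord (R : realType) (F : ratfun R) (z : option R[i]) : nat :=
  match z with
  | Some w => mup w (rden F)
  | None => (size (rnum F) - size (rden F))%N
  end.
Arguments poleord {R}.

Definition is_real_fun (R : realType) (F : ratfun R) : Prop :=
  forall z : R[i], feval F z^* = (feval F z)^*.
Arguments is_real_fun {R}.

(* An integral divisor supported in Rbar is given by the multiset (list) of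
   its points, counted with multiplicity; its value at z in Cbar is: *)
Definition divval (R : realType) (D : seq (option R)) (z : option R[i]) : nat :=
  count_mem z (map (@embC R) D).
Arguments divval {R}.

Definition in_L (R : realType) (D : seq (option R)) (F : ratfun R) : Prop :=
  forall z : option R[i], (poleord F z <= divval D z)%N.
Arguments in_L {R}.

Definition supnorm_le1 (R : realType) (E : set (option R)) (F : ratfun R) : Prop :=
  forall t, E t -> `|feval_Rbar F t| <= 1.
Arguments supnorm_le1 {R}.

Definition rfun (R : realType) (z : R[i]) (c : option R) : R[i] :=
  match c with
  | Some a => 1 / (real_complex R a - z)
  | None => z
  end.
Arguments rfun {R}.

Definition has_lim_at (R : realType) (F : ratfun R) (xs : option R) (d : nat)
    (l : R[i]) : Prop :=
  forall eps : R, 0 < eps ->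
    match xs with
    | Some a => exists delta : R, 0 < delta /\
        forall x : R, 0 < `|x - a| < delta ->
          `|feval F (real_complex R x) / rfun (real_complex R x) xs ^+ d - l| < real_complex R eps
    | None => exists M : R,
        forall x : R, M < `|x| ->
          `|feval F (real_complex R x) / rfun (real_complex R x) xs ^+ d - l| < real_complex R eps
    end.
Arguments has_lim_at {R}.

Definition admissible (R : realType) (E : set (option R)) (D : seq (option R))
    (F : ratfun R) : Prop :=
  in_L D F /\ supnorm_le1 E F.
Arguments admissible {R}.

Definition dn (R : realType) (D : seq (option R)) (xs : option R) : nat :=
  divval D (embC xs).
Arguments dn {R}.

Definition m_n (R : realType) (E : set (option R)) (D : seq (option R))
    (xs : option R) : R :=
  sup [set complex.Re l | l in
        [set l | exists G, admissible E D G /\ has_lim_at G xs (dn D xs) l]].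
Arguments m_n {R}.

Definition extremal (R : realType) (E : set (option R)) (D : seq (option R))
    (xs : option R) (F : ratfun R) : Prop :=
  admissible E D F /\
  exists l, has_lim_at F xs (dn D xs) l /\ complex.Re l = m_n E D xs.
Arguments extremal {R}.

Definition sign_fun (R : realType) (D : seq (option R)) (xs : option R)
    (x : option R) : int :=
  \sum_(c <- undup D | c != xs)
     ((count_mem c D)%:Z * (if `[< in_halfopen xs c x >] then 1 else 0)).
Arguments sign_fun {R}.

Definition alternation_set (R : realType) (E : set (option R))
    (D : seq (option R)) (xs : option R) (F : ratfun R) (X : seq (option R)) : Prop :=
  (forall x, x \in X -> E x) /\ uniq X /\
  cyc_ordered (xs :: X) /\
  forall j : nat, (j < size X)%N ->
    feval_Rbar F (nth None X j) =
      (-1) ^ ((size X)%:Z - (j.+1)%:Z - sign_fun D xs (nth None X j)).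

Arguments alternation_set {R}.

(* Main.v *)
Require Import Defs.
From HB Require Import structures.
From mathcomp Require Import all_boot all_order all_algebra.
From mathcomp Require Import ring lra zify complex.
From mathcomp Require Import all_classical all_reals all_analysis.
Set Implicit Arguments.
Unset Strict Implicit.
Unset Printing Implicit Defensive.
Import Order.TTheory GRing.Theory Num.Theory.
Import numFieldNormedType.Exports.
Local Open Scope classical_set_scope.
Local Open Scope ring_scope.

(* The coordinate w = r(t, xs) moves xs to oo and preserves the cyclic order,
   so cyclically ordered sequences starting at xs become increasing sequences
   of reals.  In it L_n consists of the functions P/W with deg P <= n and
   W = prod (X - w(c)) over the points c <> xs of the divisor; the functional
   is the coefficient P_n, and (-1)^S_n is the sign of W.  An alternation set is
   a set of n+1 points at which P = +|W|, -|W|, +|W|, ... from right to left.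

   Alternation implies extremality and uniqueness by the Lagrange formula
   P_n = sum_j P(x_j) / prod_(k <> j) (x_j - x_k), whose weights alternate in
   sign.  Conversely, if no n+1 points alternate, there is a polynomial H of
   degree <= n with H_n <= 0 and the sign of P at every point where |P| = |W|;
   for small e > 0 the polynomial P - e H is strictly below |W| on the compact
   set, so a multiple of it by a factor > 1 is a better competitor. *)

(** * Lagrange interpolation and alternation of signs *)

Lemma poly_eq0_of_roots (K : idomainType) (s : seq K) (p : {poly K}) :
  uniq s -> (size p <= size s)%N -> (forall x, x \in s -> p.[x] = 0) -> p = 0.
Proof.
move=> us sp hp; apply: (@roots_geq_poly_eq0 _ p s) => //.
by apply/allP => x /hp; rewrite /root => ->.
Qed.

(** The interpolant [L] agrees with [p] at all nodes and has the same degree bound, so [L = p]; each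
    basis product [B x] is monic of degree [size s - 1], which leaves only the weights in the top
    coefficient. *)
Lemma lagrange_top_coef (K : fieldType) (s : seq K) (p : {poly K}) :
  uniq s -> (size p <= size s)%N ->
  p`_(size s).-1 = \sum_(x <- s) p.[x] / \prod_(y <- s | y != x) (x - y).
Proof.
move=> us sp.
pose B (x : K) := \prod_(y <- s | y != x) ('X - y%:P).
have szB x : x \in s -> size (B x) = size s.
  move=> xs; rewrite /B -big_filter size_prod_XsubC size_filter.
  have := count_predC (pred1 x) s; rewrite count_uniq_mem // xs add1n => <-.
  by congr (_.+1); apply: eq_count.
have BE x z : (B x).[z] = \prod_(y <- s | y != x) (z - y).
  by rewrite horner_prod; apply: eq_bigr => y _; rewrite !hornerE.
have BN x : (B x).[x] != 0.
  rewrite BE; elim: (s) => [|y s' IH]; first by rewrite big_nil oner_neq0.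
  rewrite big_cons; case: (eqVneq y x) => //= yx.
  by rewrite mulf_neq0 // subr_eq0 eq_sym.
pose L := \sum_(x <- s) (p.[x] / (B x).[x]) *: B x.
have -> : p`_(size s).-1 = L`_(size s).-1.
  suff /subr0_eq -> : p - L = 0 by [].
  apply: (poly_eq0_of_roots us).
    rewrite (leq_trans (size_polyD _ _)) // geq_max sp size_polyN.
    apply: (leq_trans (size_sum _ _ _)); apply/bigmax_leqP_seq => x xs _.
    by rewrite (leq_trans (size_scale_leq _ _)) // szB.
  move=> x xs; rewrite hornerD hornerN /L horner_sum (bigD1_seq x xs us) /=.
  rewrite hornerZ divfK // big1_seq ?addr0 ?subrr // => y /andP[yx _].
  rewrite hornerZ [(B y).[x]]BE -big_filter (bigD1_seq x) ?mem_filter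
    ?filter_uniq //= ?subrr ?mul0r ?mulr0 //.
  by rewrite eq_sym yx.
rewrite coef_sum; apply: eq_big_seq => x xs; rewrite coefZ BE.
have : B x \is monic by rewrite monic_prod // => y _; rewrite monicXsubC.
by rewrite monicE lead_coefE szB // => /eqP ->; rewrite mulr1.
Qed.

Definition decreasing (R : realDomainType) (s : seq R) :=
  sorted (fun x y : R => y < x) s.

Lemma decreasing_uniq (R : realDomainType) (s : seq R) : decreasing s -> uniq s.
Proof.
apply: sorted_uniq => [y x z /= xy yz|x]; last by rewrite /= ltxx.
exact: lt_trans yz xy.
Qed.

Lemma decreasing_cons (R : realDomainType) (a : R) (s : seq R) :
  decreasing (a :: s) = all (fun y => y < a) s && decreasing s.
Proof. by apply: path_sortedE => y x z /= xy /lt_trans; apply. Qed.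

(** Exactly the [i] nodes listed before [s_i] are larger than it, and each of them contributes one
    negative factor. *)
Lemma decreasing_prod_sign (R : realDomainType) (s : seq R) i :
  decreasing s -> (i < size s)%N ->
  0 < (-1) ^+ i * \prod_(y <- s | y != s`_i) (s`_i - y).
Proof.
elim: s i => [//|a s IH] i; rewrite decreasing_cons => /andP[/allP lt_a ds].
case: i => [_|i /= si].
  rewrite /= big_cons eqxx /= expr0 mul1r big_seq_cond prodr_gt0 //.
  by move=> y /andP[ys _]; rewrite subr_gt0 lt_a.
have lt_ia : s`_i < a by rewrite lt_a // mem_nth.
rewrite big_cons gt_eqF //= exprS mulN1r mulNr -mulrN -mulNr opprB.
by rewrite mulrCA mulr_gt0 ?subr_gt0 ?IH.
Qed.

(** The values and the Lagrange weights have matching signs, so the terms of the Lagrange formula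
    are nonnegative while their sum is at most 0. All values vanish, and [p] has more roots than its
    degree allows. *)
Lemma alternating_poly_eq0 (R : realFieldType) (s : seq R) (p : {poly R}) :
  decreasing s -> (size p <= size s)%N -> p`_(size s).-1 <= 0 ->
  (forall i, (i < size s)%N -> 0 <= (-1) ^+ i * p.[s`_i]) -> p = 0.
Proof.
move=> ds sp; rewrite (lagrange_top_coef (decreasing_uniq ds) sp).
rewrite (big_nth 0) big_mkord => top alt.
have sgE i (u v : R) : u / v = ((-1) ^+ i * u) / ((-1) ^+ i * v).
  by rewrite -mulf_div divff ?mul1r ?signr_eq0.
have term_ge0 (i : 'I_(size s)) : true ->
    0 <= p.[s`_i] / \prod_(y <- s | y != s`_i) (s`_i - y).
  by move=> _; rewrite (sgE i) divr_ge0 ?alt // ltW ?decreasing_prod_sign.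
have := psumr_eq0P term_ge0 (le_anti _).
rewrite top sumr_ge0 // => /(_ isT) all0.
apply: (poly_eq0_of_roots (decreasing_uniq ds) sp) => x xs.
have si : (index x s < size s)%N by rewrite index_mem.
have := all0 (Ordinal si) isT; rewrite /= nth_index // => /eqP.
rewrite mulf_eq0 invr_eq0 => /orP[/eqP //|].
have := decreasing_prod_sign ds si; rewrite nth_index //.
by case: eqP => // ->; rewrite mulr0 ltxx.
Qed.

(** Makes the supremum of the extremal problem finite; there [B] is the absolute value of the
    weight. *)
Lemma top_coef_bound (R : realFieldType) (s : seq R) (B : R -> R) (p : {poly R}) :
  uniq s -> (size p <= size s)%N ->
  (forall x, x \in s -> `|p.[x]| <= B x) ->
  p`_(size s).-1 <= \sum_(x <- s) B x / `|\prod_(y <- s | y != x) (x - y)|.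
Proof.
move=> us sp pB; rewrite lagrange_top_coef //.
apply: (le_trans (ler_norm _)); apply: (le_trans (ler_norm_sum _ _ _)).
rewrite big_seq [leRHS]big_seq; apply: ler_sum => x xs.
by rewrite normf_div ler_wpM2r ?invr_ge0 ?pB.
Qed.

(** * Improving a polynomial without alternation *)

(** The point [r] becomes the root of a linear factor that changes sign between [s] and the points
    of [B] to its right. *)
Lemma closed_right_gap (R : realType) (B : set R) (s : R) :
  closed B -> ~ B s ->
  exists2 r : R, s < r & forall x, B x -> s <= x -> r < x.
Proof.
move=> cB Bs; have [e /= e0 eB] : nbhs s (~` B).
  by apply/open_nbhs_nbhs; split => //; exact: closed_openC.
exists (s + e / 2); first by rewrite ltrDl divr_gt0.
move=> x Bx sx; rewrite ltNge; apply/negP => xle; apply: (eB x) => //=.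
rewrite distrC ger0_norm ?subr_ge0 // ltrBlDl (le_lt_trans xle) //.
by rewrite ltrD2l ltr_pdivrMr // ltr_pMr // ltr1n.
Qed.

Lemma closed_sup_mem (R : realType) (A : set R) :
  closed A -> A !=set0 -> has_ubound A -> A (sup A).
Proof. by move=> cA A0 uA; apply: cA; exact: closure_sup. Qed.

Fixpoint alternating (R : realType) (A B : set R) (s : seq R) : Prop :=
  if s is x :: s' then A x /\ alternating B A s' else True.

Lemma sub_alternating (R : realType) (A B A' B' : set R) (s : seq R) :
  (forall x, x \in s -> A x -> A' x) -> (forall x, x \in s -> B x -> B' x) ->
  alternating A B s -> alternating A' B' s.
Proof.
elim: s A B A' B' => [//|a s IH] A B A' B' AA BB [Aa alt]; split.
  by apply: AA => //; rewrite inE eqxx.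
apply: IH alt => x xs; [apply: BB|apply: AA]; by rewrite inE xs orbT.
Qed.

(** Induction on the number of sign changes, placing one root per step just to the right of [sup A].
    Starting from a negative constant and multiplying by monic factors keeps the coefficient of
    degree [m] nonpositive. *)
Lemma separating_poly (R : realType) m (A B : set R) :
  closed A -> closed B -> has_ubound A -> A `&` B = set0 ->
  (forall s, size s = m.+1 -> decreasing s -> ~ alternating A B s) ->
  exists H : {poly R}, [/\ (size H <= m.+1)%N, H`_m <= 0,
    forall x, A x -> 0 < H.[x] & forall x, B x -> H.[x] < 0].
Proof.
elim: m A B => [|m IH] A B cA cB uA dAB noalt.
  (* A single point of [A] would already be an alternating sequence, so [A] is empty here. *)
  exists (-1)%:P; split; first exact: size_polyC_leq1.
  - by rewrite coefC /= lerN10.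
  - by move=> x Ax; case: (noalt [:: x]).
  - by move=> x _; rewrite hornerC ltrN10.
have [A0|/eqP/set0P Ane] := pselect (A = set0).
  exists (-1)%:P; split; first by rewrite (leq_trans (size_polyC_leq1 _)).
  - by rewrite coefC.
  - by move=> x; rewrite A0.
  - by move=> x _; rewrite hornerC ltrN10.
set s := sup A; have As : A s by exact: closed_sup_mem.
have ubs x : A x -> x <= s by move=> Ax; exact: ub_le_sup.
have nBs : ~ B s by move=> Bs; have : (A `&` B) s by []; rewrite dAB.
have [r sr Br] := closed_right_gap cB nBs.
pose B1 := B `&` [set x | x <= s]; pose B2 := B `&` [set x | s <= x].
(* Left of s the roles of A and B are exchanged; the part of B right of s joins
   A because the factor X - r changes sign between s and that part. *)
have [||||u su du alt|H [szH topH HB1 HA]] := IH B1 (A `|` B2).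
- by apply: closedI => //; exact: closed_le.
- by apply: closedU => //; apply: closedI => //; exact: closed_ge.
- by exists s => x [].
- rewrite -subset0 => x [[Bx /= xs] [Ax|[_ /= sx]]].
    by have : (A `&` B) x by []; rewrite dAB.
  by apply: nBs; rewrite (le_anti (_ : s <= x <= s)) ?sx.
(* The head of [u] lies in [B1], hence strictly left of [s], and the rest descends from it. So [u]
   misses [B2], and [s :: u] would alternate between [A] and [B]. *)
- have u_lt x : x \in u -> x < s.
    case: u su du alt => [//|a u] _; rewrite decreasing_cons.
    move=> /andP[/allP ua _] [[Ba /= als] _].
    have as' : a < s.
      by rewrite lt_neqAle als andbT; apply: contra_notN nBs => /eqP <-.
    by rewrite inE => /orP[/eqP -> //|/ua /lt_trans]; apply.
  apply: (noalt (s :: u)); first by rewrite /= su.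
    by rewrite decreasing_cons du andbT; apply/allP.
  split => //; apply: sub_alternating alt => x xu; first by case.
  by case=> // -[_ /= /le_lt_trans/(_ (u_lt _ xu))]; rewrite ltxx.
exists (H * ('X - r%:P)); split.
- rewrite (leq_trans (size_polyMleq _ _)) // size_XsubC addn2 /=.
  by rewrite ltnS.
- by rewrite mulrBr coefB coefMX coefMC /= [H`_m.+1]nth_default ?mul0r ?subr0.
- move=> x Ax; rewrite hornerM hornerXsubC nmulr_rgt0; last by apply: HA; left.
  by rewrite subr_lt0 (le_lt_trans (ubs _ Ax)).
- move=> x Bx; rewrite hornerM hornerXsubC; have [xs|sx] := leP x s.
    by rewrite pmulr_rlt0 ?subr_lt0 ?(le_lt_trans xs) //; exact: HB1.
  rewrite nmulr_rlt0 ?subr_gt0 ?Br ?ltW //; apply: HA; right; split => //=.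
  exact: ltW.
Qed.

Lemma compact_pos_lower_bound (R : realType) (K : set R) (f : R -> R) :
  compact K -> continuous f -> (forall x, K x -> 0 < f x) ->
  exists2 m : R, 0 < m & forall x, K x -> m <= f x.
Proof.
move=> cK cf fpos; have [->|/eqP/set0P K0] := pselect (K = set0).
  by exists 1.
have [c /set_mem Kc cmin] := compact_EVT_min K0 cK (continuous_subspaceT cf).
by exists (f c) => [|x Kx]; [exact: fpos|apply: cmin; exact/mem_set].
Qed.

Lemma compact_norm_bounded (R : realType) (K : set R) (f : R -> R) :
  compact K -> continuous f ->
  exists2 b : R, 0 < b & forall x, K x -> `|f x| <= b.
Proof.
move=> cK cf; have [->|/eqP/set0P K0] := pselect (K = set0).
  by exists 1.
have cg : continuous (fun x => `|f x|).
  by move=> x; apply: cvg_norm; exact: cf.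
have [c /set_mem Kc cmax] := compact_EVT_max K0 cK (continuous_subspaceT cg).
exists (1 + `|f c|) => [|x Kx]; first by rewrite ltr_pwDl.
by rewrite (le_trans (cmax x (mem_set Kx))) // lerDr.
Qed.

Lemma norm_le_sqr (R : realDomainType) (x y : R) :
  x ^+ 2 <= y ^+ 2 -> `|x| <= `|y|.
Proof.
by rewrite -(real_normK (num_real x)) -(real_normK (num_real y)) ler_sqr ?nnegrE.
Qed.

(** With [U = Q^2 - P^2], one has [Q^2 - (P - e H)^2 = U + 2 e P H - e^2 H^2]. By compactness [U] or
    [P H] exceeds a fixed [m' > 0] at each point, so a small [e] leaves a uniform margin [c], which
    pays for the factor [1 + d]. *)
Lemma scaled_perturbation_le (R : realType) (K : set R) (P Q H : {poly R}) :
  compact K -> (forall x, K x -> `|P.[x]| <= `|Q.[x]|) ->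
  (forall x, K x -> `|P.[x]| = `|Q.[x]| -> 0 < P.[x] * H.[x]) ->
  exists e d : R, [/\ 0 < e, 0 < d &
    forall x, K x -> `|((1 + d) *: (P - e *: H)).[x]| <= `|Q.[x]|].
Proof.
move=> cK PQ PH.
pose u := Q ^+ 2 - P ^+ 2; pose h := P * H.
have u0 x : K x -> 0 <= u.[x].
  move=> Kx; rewrite !hornerE subr_ge0 -(real_normK (num_real P.[x])).
  by rewrite -(real_normK (num_real Q.[x])) ler_sqr ?nnegrE ?PQ.
have [|x Kx|m m0 mle] := @compact_pos_lower_bound R K
    (fun x => (u + h).[x] + `|(u - h).[x]|) cK.
- move=> x; apply: cvgD; first exact: continuous_horner.
  by apply: cvg_norm; exact: continuous_horner.
- rewrite hornerD; have := u0 _ Kx; rewrite le_eqVlt => /predU1P[ux|ux].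
    have hx : 0 < h.[x].
      rewrite hornerM PH //; move/esym/eqP: ux; rewrite !hornerE subr_eq0.
      by rewrite eqf_sqr => /orP[]/eqP ->; rewrite ?normrN.
    by rewrite -ux add0r ltr_pwDl.
  have := ler_norm (u - h).[x]; rewrite hornerD hornerN; lra.
have [|b b0 ble] := @compact_norm_bounded R K
    (fun x => `|h.[x]| + `|(H ^+ 2).[x]| + `|(Q ^+ 2).[x]|) cK.
  by move=> x; do 2?apply: cvgD; apply: cvg_norm; exact: continuous_horner.
pose m' := m / 2; have m'0 : 0 < m' by rewrite divr_gt0.
(* This gives [e <= 1] and [m' - 3 e b >= e m'], which settles the case [U >= m']; where
   [P H >= m'], the term [2 e m'] exceeds [e^2 H^2] by at least [e m']. *)
pose e := m' / (4 * b + m').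
have e0 : 0 < e by apply: divr_gt0; lra.
have eE : e * (4 * b + m') = m' by rewrite divfK // gt_eqF //; lra.
have e1 : e <= 1 by rewrite ler_pdivrMr; lra.
pose c := e * m' / 4; have c0 : 0 < c.
  by apply: divr_gt0 => //; exact: mulr_gt0.
(* Then [d <= 1], so [(1 + d)^2 <= 1 + 3 d], and [3 d Q^2 <= 3 d b <= c] is absorbed by the
   margin. *)
pose d := c / (3 * b + c).
have d0 : 0 < d by apply: divr_gt0; lra.
have dE : d * (3 * b + c) = c by rewrite divfK // gt_eqF //; lra.
have d1 : d <= 1 by rewrite ler_pdivrMr; lra.
exists e, d; split => // x Kx; apply: norm_le_sqr.
have := ble _ Kx; have := u0 _ Kx; have := mle _ Kx.
rewrite !hornerE /=; move: (P.[x]) (Q.[x]) (H.[x]) => p q k.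
set U := q ^+ 2 - p ^+ 2; move=> mlex U0.
rewrite ger0_norm; last by rewrite !addr_ge0.
move=> bx.
have [hb1 hb2] : `|p * k| <= b /\ k ^+ 2 <= b.
  have := normr_ge0 (p * k); have := normr_ge0 (k ^+ 2).
  have := normr_ge0 (q ^+ 2); have := ler_norm (k ^+ 2); lra.
have qb : q ^+ 2 <= b.
  have := normr_ge0 (p * k); have := normr_ge0 (k ^+ 2).
  have := normr_ge0 (q ^+ 2); have := ler_norm (q ^+ 2); lra.
have hb3 : - b <= p * k by have := ler_norm (- (p * k)); rewrite normrN; lra.
have k0 : 0 <= k ^+ 2 by exact: sqr_ge0.
have eb : 0 <= e * b by rewrite mulr_ge0 // ltW.
have em : 0 <= e * m' by rewrite mulr_ge0 // ltW.
have ee : e ^+ 2 <= e by rewrite expr2 ler_piMr // ltW.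
have eek : e ^+ 2 * k ^+ 2 <= e * b by rewrite ler_pM // exprn_ge0 // ltW.
(* m bounds U + p k + |U - p k|, which is twice the maximum of U and p k. *)
have key : c <= U + 2 * e * (p * k) - e ^+ 2 * k ^+ 2.
  have [mU|mH] : m' <= U \/ m' <= p * k.
    rewrite /m'; have [?|?] := leP 0 (U - p * k); [left|right]; move: mlex.
      by rewrite ger0_norm //; lra.
    by rewrite ltr0_norm //; lra.
  - have : e * (- b) <= e * (p * k) by rewrite ler_wpM2l // ltW.
    rewrite /c; move: eE eek eb em; rewrite mulrDr mulrN => *; nra.
  have : e * m' <= e * (p * k) by rewrite ler_wpM2l // ltW.
  have : e ^+ 2 * k ^+ 2 <= e * (e * b).
    by rewrite expr2 -mulrA ler_wpM2l ?(ltW e0) // ler_wpM2l ?(ltW e0).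
  have : e * (e * b) <= e * m'.
    rewrite ler_wpM2l ?(ltW e0) // -[leRHS]eE mulrDr; move: em eb => *; lra.
  rewrite /c; lra.
have r2 : (p - e * k) ^+ 2 <= q ^+ 2 - c.
  have -> : (p - e * k) ^+ 2 = q ^+ 2 - (U + 2 * e * (p * k) - e ^+ 2 * k ^+ 2).
    by rewrite /U; ring.
  lra.
rewrite exprMn.
have -> : (1 + d) ^+ 2 = 1 + 2 * d + d * d by ring.
have dd : d * d <= d by rewrite ler_piMr // ltW.
have r0 := sqr_ge0 (p - e * k).
have s1 : (1 + 2 * d + d * d) * (p - e * k) ^+ 2 <= (1 + 3 * d) * (p - e * k) ^+ 2.
  by rewrite ler_wpM2r //; lra.
have s2 : (1 + 3 * d) * (p - e * k) ^+ 2 <= (1 + 3 * d) * (q ^+ 2 - c).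
  by rewrite ler_wpM2l //; lra.
have s3 : d * q ^+ 2 <= d * b by rewrite ler_wpM2l // ltW.
have s4 : 0 <= d * c by rewrite mulr_ge0 // ltW.
move: dE; rewrite mulrDr => dE.
apply: (le_trans s1); apply: (le_trans s2).
have -> : (1 + 3 * d) * (q ^+ 2 - c) =
    q ^+ 2 - c + 3 * (d * q ^+ 2) - 3 * (d * c) by ring.
lra.
Qed.

(** Supplies a competitor with positive top coefficient when that of the given polynomial is not
    positive. *)
Lemma monomial_le (R : realType) (K : set R) (Q : {poly R}) n :
  compact K -> (forall x, K x -> Q.[x] != 0) ->
  exists2 c : R, 0 < c & forall x, K x -> `|(c *: 'X^n).[x]| <= `|Q.[x]|.
Proof.
move=> cK Q0.
have [|x Kx|m m0 mle] := @compact_pos_lower_bound R K (fun x => `|Q.[x]|) cK.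
- by move=> x; apply: cvg_norm; exact: continuous_horner.
- by rewrite normr_gt0 Q0.
have [|b b0 ble] := @compact_norm_bounded R K (horner 'X^n) cK.
  exact: continuous_horner.
exists (m / b) => [|x Kx]; first exact: divr_gt0.
rewrite hornerZ normrM gtr0_norm ?divr_gt0 //.
apply: le_trans (mle _ Kx); rewrite -mulrA ger_pMr //.
by rewrite mulrC ler_pdivrMr ?mul1r ?ble.
Qed.

(** If [P_n > 0], the separating polynomial [H] has the sign of [P] where [|P| = |Q|]. As
    [H_n <= 0], subtracting [e H] does not lower the top coefficient, and the factor [1 + d]
    strictly raises it. If [P_n <= 0], a small multiple of [X^n] is already better. *)
Lemma larger_top_coef (R : realType) (K : set R) (P Q : {poly R}) n :
  compact K -> (size P <= n.+1)%N ->
  (forall x, K x -> Q.[x] != 0) -> (forall x, K x -> `|P.[x]| <= `|Q.[x]|) ->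
  (forall s, size s = n.+1 -> decreasing s ->
     ~ alternating (K `&` [set x | P.[x] = `|Q.[x]|])
                   (K `&` [set x | P.[x] = - `|Q.[x]|]) s) ->
  exists P2 : {poly R}, [/\ (size P2 <= n.+1)%N, P`_n < P2`_n &
    forall x, K x -> `|P2.[x]| <= `|Q.[x]|].
Proof.
move=> cK sP Q0 PQ noalt; have [Pn|Pn] := leP P`_n 0.
  have [c c0 cle] := monomial_le n cK Q0; exists (c *: 'X^n); split => //.
    by rewrite (leq_trans (size_scale_leq _ _)) // size_polyXn.
  by rewrite coefZ coefXn eqxx mulr1 (le_lt_trans Pn).
have clK : closed K by apply: compact_closed cK; exact: Rhausdorff.
have cl (f : R -> R) : continuous f -> closed (K `&` [set x | f x = 0]).
  move=> cf; apply: closedI => //.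
  apply: (@closed_comp _ _ f [set x | x = 0]) => [x _|]; first exact: cf.
  exact: closed_eq.
have Q0' x : K x -> 0 < `|Q.[x]| by move=> Kx; rewrite normr_gt0 Q0.
have cQ : continuous (fun x => `|Q.[x]|).
  by move=> x; apply: cvg_norm; exact: continuous_horner.
have [||||H [sH Hn HA HB]] := separating_poly (m := n) _ _ _ _ noalt.
- rewrite (_ : _ `&` _ = K `&` [set x | P.[x] - `|Q.[x]| = 0]).
    by apply: cl => x; apply: cvgB; [exact: continuous_horner|exact: cQ].
  by congr (_ `&` _); apply/seteqP; split => x /= /eqP;
     [rewrite -subr_eq0|rewrite subr_eq0] => /eqP.
- rewrite (_ : _ `&` _ = K `&` [set x | P.[x] + `|Q.[x]| = 0]).
    by apply: cl => x; apply: cvgD; [exact: continuous_horner|exact: cQ].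
  by congr (_ `&` _); apply/seteqP; split => x /= /eqP;
     [rewrite -addr_eq0|rewrite addr_eq0] => /eqP.
- have [b b0 ble] := @compact_norm_bounded R K id cK (fun x => cvg_id).
  by exists b => x [/ble + _]; exact: le_trans (ler_norm _).
- rewrite -subset0 => x [[Kx /= ->] [_ /= /eqP]].
  by rewrite -addr_eq0 -mulr2n mulrn_eq0 /= normr_eq0 (negbTE (Q0 _ Kx)).
have [|e [d [e0 d0 le2]]] := @scaled_perturbation_le R K P Q H cK PQ.
  move=> x Kx PQx; have [P0|P0] := leP 0 P.[x].
    have PE : P.[x] = `|Q.[x]| by rewrite -PQx ger0_norm.
    by rewrite mulr_gt0 ?HA // PE Q0'.
  by rewrite nmulr_rgt0 // HB //; split => //=; rewrite -PQx ltr0_norm ?opprK.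
exists ((1 + d) *: (P - e *: H)); split => //.
  rewrite (leq_trans (size_scale_leq _ _)) // (leq_trans (size_polyD _ _)) //.
  by rewrite geq_max sP size_polyN (leq_trans (size_scale_leq _ _)).
rewrite coefZ coefB coefZ mulrDl mul1r.
have : 0 <= - (e * H`_n) by rewrite -mulrN mulr_ge0 ?oppr_ge0 // ltW.
have : 0 < d * (P`_n - e * H`_n).
  by rewrite mulr_gt0 // ltr_wpDr // -mulrN mulr_ge0 ?oppr_ge0 // ltW.
lra.
Qed.

(** * Rational functions with prescribed poles *)

Lemma mup_XsubC (K : fieldType) (x z : K) : mup x ('X - z%:P) = (z == x).
Proof. by have := mup_XsubCX 1 x z; rewrite expr1 => ->; case: eqP. Qed.

Lemma dvdp_prod_XsubC_mup (K : fieldType) (r : seq K) (q : {poly K}) :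
  q != 0 -> (forall x, (count_mem x r <= mup x q)%N) ->
  \prod_(z <- r) ('X - z%:P) %| q.
Proof.
elim: r q => [|z r IH] q q0 le_mup; first by rewrite big_nil dvd1p.
have : 'X - z%:P %| q.
  by rewrite XsubC_dvd // (leq_trans _ (le_mup z)) //= eqxx.
case/dvdpP => q' qE; rewrite big_cons qE mulrC dvdp_mul2r ?polyXsubC_eq0 //.
have q'0 : q' != 0 by apply: contraNneq q0 => q'0; rewrite qE q'0 mul0r.
apply: IH => // x; have := le_mup x; rewrite qE mupM ?polyXsubC_eq0 //=.
by rewrite mup_XsubC addnC leq_add2r.
Qed.

Lemma mup_prod_XsubC (K : fieldType) (r : seq K) x :
  mup x (\prod_(z <- r) ('X - z%:P)) = count_mem x r.
Proof.
elim: r => [|z r IH]; first by rewrite big_nil mupNroot // root1.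
rewrite big_cons mupM ?polyXsubC_eq0 //; last first.
  by apply: monic_neq0; rewrite monic_prod // => y _; rewrite monicXsubC.
by rewrite IH mup_XsubC.
Qed.

(** Over an algebraically closed field [p] splits, so divisibility can be tested root by root. *)
Lemma dvdp_mup (K : closedFieldType) (p q : {poly K}) :
  p \is monic -> q != 0 -> (forall x, (mup x p <= mup x q)%N) -> p %| q.
Proof.
move=> mp q0; have [r ->] := closed_field_poly_normal p.
rewrite (monicP mp) scale1r => le_mup; apply: dvdp_prod_XsubC_mup => // x.
by rewrite -mup_prod_XsubC.
Qed.

(** Cancel the gcd and normalize the denominator. The relation is kept cross-multiplied so that it
    holds between polynomials, poles included. *)
Lemma ratfun_of_fraction (R : realType) (N M : {poly R[i]}) :
  M \is monic -> exists F : ratfun R, rnum F * M = N * rden F.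
Proof.
move=> mM; have M0 := monic_neq0 mM; set g := gcdp N M.
have g0 : g != 0 by rewrite gcdp_eq0 negb_and M0 orbT.
have NE : N = N %/ g * g by rewrite divpK // dvdp_gcdl.
have ME : M = M %/ g * g by rewrite divpK // dvdp_gcdr.
have Mg0 : M %/ g != 0 by apply: contraNneq M0 => e; rewrite ME e mul0r.
set l := lead_coef (M %/ g); have l0 : l != 0 by rewrite lead_coef_eq0.
have mon : l^-1 *: (M %/ g) \is monic by rewrite monicE lead_coefZ mulVf.
have cop : coprimep (l^-1 *: (N %/ g)) (l^-1 *: (M %/ g)).
  rewrite coprimepZl ?coprimepZr ?invr_eq0 //.
  by rewrite coprimep_div_gcd // M0 orbT.
exists (RatFun mon cop) => /=.
rewrite {1}ME {2}NE -!scalerAl -!scalerAr; congr (_ *: _).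
by rewrite mulrA mulrAC.
Qed.

Lemma ratfun_eq (R : realType) (F G : ratfun R) :
  rnum F = rnum G -> rden F = rden G -> F = G.
Proof.
case: F G => [n1 d1 m1 c1] [n2 d2 m2 c2] /= en ed.
case: _ / en c2 m2 ed => c2 m2 ed; case: _ / ed c2 m2 => c2 m2.
by rewrite (bool_irrelevance c1 c2) (bool_irrelevance m1 m2).
Qed.

(** Coprimality makes the two denominators divide each other, and being monic they coincide. *)
Lemma ratfun_cross_eq (R : realType) (F G : ratfun R) :
  rnum F * rden G = rnum G * rden F -> F = G.
Proof.
move=> e.
have dFG : rden F %| rden G.
  rewrite -(@Gauss_dvdpr _ _ (rnum F)) ?e ?dvdp_mull //.
  by rewrite coprimep_sym rfrac_coprime.
have dGF : rden G %| rden F.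
  rewrite -(@Gauss_dvdpr _ _ (rnum G)) -?e ?dvdp_mull //.
  by rewrite coprimep_sym rfrac_coprime.
have ed : rden F = rden G.
  by apply/eqP; rewrite -eqp_monic ?rden_monic // /eqp dFG.
apply: ratfun_eq => //; move: e; rewrite ed; apply: mulIf.
by rewrite monic_neq0 // rden_monic.
Qed.

(** The binary form of degree [n] attached to [p], at [(u, v)]: for [deg p <= n] this is
    [v^n p(u/v)] without division. It carries numerators through a Möbius change of variable. *)
Definition homogenize (K : comNzRingType) n (p u v : {poly K}) : {poly K} :=
  \sum_(i < n.+1) p`_i *: (u ^+ i * v ^+ (n - i)).

Lemma size_homogenize (K : idomainType) n (p u v : {poly K}) :
  (size u <= 2)%N -> (size v <= 2)%N -> (size (homogenize n p u v) <= n.+1)%N.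
Proof.
move=> su sv; apply: (leq_trans (size_sum _ _ _)); apply/bigmax_leqP => i _.
rewrite (leq_trans (size_scale_leq _ _)) // (leq_trans (size_polyMleq _ _)) //.
have sX (w : {poly K}) k : (size w <= 2)%N -> (size (w ^+ k) <= k.+1)%N.
  move=> sw; rewrite (leq_trans (size_poly_exp_leq _ _)) // ltnS.
  by rewrite -[leqRHS]mul1n leq_mul2r; case: (size w) sw => [|[|[]]] //; rewrite orbT.
have := sX u i su; have := sX v (n - i)%N sv; have := ltn_ord i.
case: (size (u ^+ i)) (size (v ^+ (n - i))) => [|a] [|b]; lia.
Qed.

Lemma horner_homogenize (K : fieldType) n (p u v : {poly K}) x :
  (size p <= n.+1)%N -> v.[x] != 0 ->
  (homogenize n p u v).[x] = v.[x] ^+ n * p.[u.[x] / v.[x]].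
Proof.
move=> sp v0; rewrite horner_sum (horner_coef_wide _ sp) mulr_sumr.
apply: eq_bigr => i _; rewrite hornerZ hornerM !horner_exp.
have -> : v.[x] ^+ n = v.[x] ^+ (n - i) * v.[x] ^+ i.
  by rewrite -exprD subnK // -ltnS.
by rewrite expr_div_n; field; rewrite expf_neq0.
Qed.

(** The summand of index [i] has degree at most [n - i], so only the constant coefficient of [p]
    reaches degree [n]. This gives the value at oo after the change of coordinate. *)
Lemma homogenize_top_coef (K : idomainType) n (p : {poly K}) (a : K) :
  (homogenize n p 1 (a%:P - 'X))`_n = (-1) ^+ n * p`_0.
Proof.
have -> : a%:P - 'X = -1 *: ('X - a%:P) by rewrite scaleN1r opprB.
rewrite coef_sum big_ord_recl /= big1 ?addr0 => [|i _].
  rewrite mul1r subn0 coefZ exprZn coefZ.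
  have : ('X - a%:P) ^+ n \is monic by rewrite monic_exp // monicXsubC.
  by rewrite monicE lead_coefE size_exp_XsubC /= => /eqP ->; rewrite mulr1 mulrC.
rewrite expr1n mul1r coefZ [X in _ * X]nth_default ?mulr0 //.
rewrite exprZn (leq_trans (size_scale_leq _ _)) // size_exp_XsubC.
by rewrite ltn_subrL /=; case: n i => // -[].
Qed.

(** The estimate [p = O(w^(n-1))], with one factor [|w|] moved to the left so that no exponent
    [n - 1] occurs at [n = 0]. *)
Lemma poly_growth (K : numFieldType) n (p : {poly K}) :
  (size p <= n)%N ->
  exists2 C : K, 0 <= C &
    forall w, 1 <= `|w| -> `|p.[w]| * `|w| <= C * `|w| ^+ n.
Proof.
move=> sp; exists (\sum_(i < n) `|p`_i|); first by rewrite sumr_ge0.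
move=> w w1; rewrite (horner_coef_wide _ sp).
apply: (le_trans (ler_wpM2r _ (ler_norm_sum _ _ _))) => //.
rewrite !mulr_suml; apply: ler_sum => i _.
rewrite normrM normrX -mulrA -exprSr ler_wpM2l //.
by rewrite ler_weXn2l.
Qed.

(** Both [P - P_n M] and [X^n - M] have degree below [n]. The second makes [|M|] comparable to
    [|w|^n], the first then makes the error small. *)
Lemma ratio_limit (K : numFieldType) n (P M : {poly K}) :
  (size P <= n.+1)%N -> M \is monic -> size M = n.+1 ->
  forall e : K, 0 < e -> exists2 B : K, 0 < B &
    forall w, B < `|w| -> M.[w] != 0 /\ `|P.[w] / M.[w] - P`_n| < e.
Proof.
move=> sP mM sM e e0; have topM : M`_n = 1.
  by move: mM; rewrite monicE lead_coefE sM => /eqP.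
have size_top (q : {poly K}) : (size q <= n.+1)%N -> q`_n = 0 -> (size q <= n)%N.
  move=> sq qn; apply/leq_sizeP => j; rewrite leq_eqVlt => /predU1P[<- //|nj].
  by rewrite nth_default // (leq_trans sq).
have sB (q q' : {poly K}) : (size q <= n.+1)%N -> (size q' <= n.+1)%N ->
    (size (q - q')%R <= n.+1)%N.
  by move=> *; rewrite (leq_trans (size_polyD _ _)) // size_polyN geq_max; apply/andP.
have [|C1 C10 hC1] := @poly_growth K n (P - P`_n *: M).
  apply: size_top; last by rewrite coefB coefZ topM mulr1 subrr.
  by rewrite sB // (leq_trans (size_scale_leq _ _)) // sM.
have [|C2 C20 hC2] := @poly_growth K n ('X^n - M).
  apply: size_top; last by rewrite coefB coefXn eqxx topM subrr.
  by rewrite sB // ?size_polyXn ?sM.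
(* The summand 1 permits the growth bounds, [2 * C2] yields [|w|^n <= 2 |M(w)|], and [2 * C1 / e]
   brings the error below [e]. *)
pose B := 1 + 2 * C2 + 2 * C1 / e.
have C2' : 0 <= 2 * C2 by rewrite mulr_ge0.
have C1' : 0 <= 2 * C1 / e by rewrite divr_ge0 ?mulr_ge0 // ltW.
exists B => [|w Bw]; first by rewrite ltr_pwDl // ltr_pwDl.
have w1 : 1 <= `|w| by rewrite ltW // (le_lt_trans _ Bw) // /B -addrA lerDl addr_ge0.
have w0 : 0 < `|w| by rewrite (lt_le_trans ltr01).
have wC2 : 2 * C2 <= `|w|.
  by rewrite ltW // (le_lt_trans _ Bw) // /B addrAC lerDr addr_ge0.
have wC1 : 2 * C1 < e * `|w|.
  rewrite [ltRHS]mulrC -ltr_pdivrMr // (le_lt_trans _ Bw) // /B lerDr addr_ge0 //.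
have wn0 : 0 < `|w| ^+ n by rewrite exprn_gt0.
have Mlow : `|w| ^+ n <= 2 * `|M.[w]|.
  have h1 : `|w| ^+ n * `|w| <= (`|M.[w]| * `|w|) + C2 * `|w| ^+ n.
    apply: le_trans (lerD (lexx _) (hC2 w w1)); rewrite -mulrDl ler_wpM2r //.
    rewrite -normrX; apply: le_trans (ler_normD _ _).
    by rewrite hornerD hornerN hornerXn addrC subrK.
  rewrite -(ler_pM2r w0).
  have h2 : 2 * (C2 * `|w| ^+ n) <= `|w| ^+ n * `|w|.
    by rewrite mulrA [leRHS]mulrC ler_wpM2r // ltW.
  have h3 : 2 * (`|w| ^+ n * `|w|) <= 2 * (`|M.[w]| * `|w| + C2 * `|w| ^+ n).
    by rewrite ler_wpM2l.
  rewrite -mulrA -(lerD2r (`|w| ^+ n * `|w|)).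
  have -> : `|w| ^+ n * `|w| + `|w| ^+ n * `|w| = 2 * (`|w| ^+ n * `|w|) by ring.
  by apply: (le_trans h3); rewrite mulrDr lerD2l.
have Mw0 : 0 < `|M.[w]|.
  by rewrite -(pmulr_rgt0 _ (ltr0Sn K 1)) (lt_le_trans wn0).
have M0 : M.[w] != 0 by rewrite -normr_gt0.
split => //.
have -> : P.[w] / M.[w] - P`_n = (P - P`_n *: M).[w] / M.[w].
  by rewrite !hornerE; field.
rewrite normf_div ltr_pdivrMr // -(ltr_pM2r w0).
apply: (le_lt_trans (hC1 w w1)).
apply: (le_lt_trans (ler_wpM2l C10 Mlow)).
by rewrite mulrA [C1 * 2]mulrC [ltRHS]mulrAC ltr_pM2r.
Qed.

(** * The space L_n over a common denominator *)

Local Notation toC := (real_complex _).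

(** A point at oo gives no factor; it is accounted for by the degree allowed to the numerator. *)
Definition denom (R : realType) (D : seq (option R)) : {poly R} :=
  \prod_(c <- D) (if c is Some x then 'X - x%:P else 1).

Lemma denom_monic (R : realType) (D : seq (option R)) : denom D \is monic.
Proof. by rewrite monic_prod // => -[x|] _; rewrite ?monicXsubC ?monic1. Qed.

Lemma size_denom (R : realType) (D : seq (option R)) :
  (size (denom D) + count_mem None D)%N = (size D).+1.
Proof.
elim: D => [|c D IH]; first by rewrite /denom big_nil size_poly1.
rewrite /denom big_cons -/(denom D); case: c => [x|] /=.
  rewrite size_Mmonic ?denom_monic ?polyXsubC_eq0 // size_XsubC.
  by rewrite add0n !addSn IH.
by rewrite mul1r addnCA add1n IH.
Qed.

Lemma embC_inj (R : realType) : injective (@embC R).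
Proof. by move=> [x|] [y|] //= [->]. Qed.

Lemma divval_embC (R : realType) (D : seq (option R)) t :
  divval D (embC t) = count_mem t D.
Proof.
rewrite /divval count_map; apply: eq_count => c /=.
by rewrite (inj_eq (@embC_inj R)).
Qed.

Lemma mup_denom (R : realType) (D : seq (option R)) (w : R[i]) :
  mup w (map_poly toC (denom D)) = divval D (Some w).
Proof.
rewrite /divval; elim: D => [|c D IH].
  by rewrite /denom big_nil rmorph1 mupNroot // root1.
rewrite /denom big_cons -/(denom D) rmorphM /= mupM; last 2 first.
- case: c => [x|]; last by rewrite rmorph1 oner_neq0.
  by rewrite map_polyXsubC polyXsubC_eq0.
- by rewrite monic_neq0 // map_monic denom_monic.
rewrite IH; congr (_ + _)%N; case: c => [x|] /=.
  by rewrite map_polyXsubC mup_XsubC.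
by rewrite rmorph1 mupNroot // root1.
Qed.

(** The finite poles are controlled exactly when [rden F] divides [denom D], and [N] is [rnum F]
    times the cofactor. The bound on the size of [N] then expresses the condition on the pole at
    oo. *)
Lemma in_LP (R : realType) (D : seq (option R)) (F : ratfun R) :
  in_L D F <-> exists2 N : {poly R[i]}, (size N <= (size D).+1)%N &
                 rnum F * map_poly toC (denom D) = N * rden F.
Proof.
have mM : map_poly toC (denom D) \is monic by rewrite map_monic denom_monic.
have sM : (size (map_poly toC (denom D)) + divval D None)%N = (size D).+1.
  by rewrite size_map_poly (divval_embC D None) size_denom.
have mup_le w : (poleord F (Some w) <= divval D (Some w))%N =
    (mup w (rden F) <= mup w (map_poly toC (denom D)))%N.
  by rewrite mup_denom.
move: (map_poly _ _) mM sM mup_le => M mM sM mup_le; have M0 := monic_neq0 mM.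
have d0 : rden F != 0 by rewrite monic_neq0 // rden_monic.
have sd : (0 < size (rden F))%N by rewrite size_poly_gt0.
have sM0 : (0 < size M)%N by rewrite size_poly_gt0.
split=> [LF|[N sN e]].
  have /dvdpP[q qE] : rden F %| M.
    by apply: dvdp_mup; rewrite ?rden_monic // => w; rewrite -mup_le; exact: LF.
  exists (rnum F * q); last by rewrite qE mulrA.
  have [->|n0] := eqVneq (rnum F) 0; first by rewrite mul0r size_poly0.
  have q0 : q != 0 by apply: contraNneq M0 => q0; rewrite qE q0 mul0r.
  have s1 : size M = (size q + size (rden F)).-1 by rewrite qE size_mul.
  have -> : size (rnum F * q) = (size (rnum F) + size q).-1 by rewrite size_mul.
  have sn0 : (0 < size (rnum F))%N by rewrite size_poly_gt0.
  have sq0 : (0 < size q)%N by rewrite size_poly_gt0.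
  (* Degree count: [a], [b], [c], [d] are the sizes of [M], [q], [rden F], [rnum F], and [k] is the
     multiplicity of oo in [D]. *)
  have ar (a b c d k m : nat) : (a + k)%N = m.+1 -> a = (b + c).-1 ->
      (0 < b -> 0 < c -> 0 < d -> d - c <= k -> (d + b).-1 <= m.+1)%N by lia.
  exact: ar sM s1 sq0 sd sn0 (LF None).
move=> [w|].
  have : rden F %| M.
    rewrite -(@Gauss_dvdpr _ _ (rnum F)) ?e ?dvdp_mull //.
    by rewrite coprimep_sym rfrac_coprime.
  rewrite mup_le => /dvdpP[q qE]; rewrite qE mupM ?leq_addl //.
  by apply: contraNneq M0 => q0; rewrite qE q0 mul0r.
have /= [->|n0] := eqVneq (rnum F) 0; first by rewrite size_poly0 sub0n.
have N0 : N != 0.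
  apply: contraTneq isT => N0; move/eqP: e.
  by rewrite N0 mul0r mulf_eq0 (negbTE n0) (negbTE M0).
have s1 : (size N + size (rden F)).-1 = (size (rnum F) + size M).-1.
  by rewrite -!size_mul // e.
have sN0 : (0 < size N)%N by rewrite size_poly_gt0.
have sn0 : (0 < size (rnum F))%N by rewrite size_poly_gt0.
have ar (a b c d k m : nat) : (a + k)%N = m.+1 -> (b + c).-1 = (d + a).-1 ->
  (0 < a -> 0 < b -> 0 < c -> 0 < d -> b <= m.+1 -> d - c <= k)%N by lia.
exact: ar sM s1 sM0 sN0 sd sn0 sN.
Qed.

(** If [rden F] vanished at [z], the relation would make [z] a root of [rnum F] too, against
    coprimality. *)
Lemma feval_frac (R : realType) (F : ratfun R) (N M : {poly R[i]}) z :
  rnum F * M = N * rden F -> M.[z] != 0 ->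
  (rden F).[z] != 0 /\ feval F z = N.[z] / M.[z].
Proof.
move=> e Mz; have ez : (rnum F).[z] * M.[z] = N.[z] * (rden F).[z].
  by rewrite -!hornerM e.
have dz : (rden F).[z] != 0.
  apply/negP => /eqP dz; move/eqP: ez; rewrite dz mulr0 mulf_eq0 (negbTE Mz) orbF.
  move=> nz; have := coprimep_root (rfrac_coprime F) nz.
  by rewrite dz eqxx.
by split => //; rewrite /feval; apply/eqP; rewrite eqr_div // ez.
Qed.

(** The quotient [N / M] tends to [N_n] at oo because [M] is monic of degree [n]; comparing degrees
    shows that the definition by cases returns this number. *)
Lemma feval_oo (R : realType) (F : ratfun R) (N M : {poly R[i]}) n :
  rnum F * M = N * rden F -> M \is monic -> size M = n.+1 ->
  (size N <= n.+1)%N -> feval_Rbar F None = N`_n.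
Proof.
move=> e mM sM sN /=.
have M0 : M != 0 by rewrite monic_neq0.
have d0 : rden F != 0 by rewrite monic_neq0 // rden_monic.
have sd : (0 < size (rden F))%N by rewrite size_poly_gt0.
have [n0|n0] := eqVneq (rnum F) 0.
  rewrite n0 size_poly0 sd; move/eqP: e; rewrite n0 mul0r eq_sym mulf_eq0.
  by rewrite (negbTE d0) orbF => /eqP ->; rewrite coef0.
have N0 : N != 0.
  apply: contraTneq isT => N0; move/eqP: e.
  by rewrite N0 mul0r mulf_eq0 (negbTE n0) (negbTE M0).
have s1 : (size N + size (rden F)).-1 = (size (rnum F) + n.+1).-1.
  by rewrite -sM -!size_mul // e.
have sN0 : (0 < size N)%N by rewrite size_poly_gt0.
have sn0 : (0 < size (rnum F))%N by rewrite size_poly_gt0.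
have ar (a b c m : nat) : (a + b).-1 = (c + m.+1).-1 ->
  (0 < a -> 0 < b -> 0 < c -> a <= m.+1 ->
   if c < b then a <= m else a == m.+1)%N by move=> *; case: (ltnP c b); lia.
have := ar _ _ _ _ s1 sN0 sd sn0 sN.
case: ltnP => sz; first by move=> sNn; rewrite nth_default.
move=> /eqP sNn.
have := congr1 lead_coef e.
rewrite !lead_coefM (monicP mM) (monicP (rden_monic F)) !mulr1 divr1 => ->.
by rewrite lead_coefE sNn.
Qed.

(** * The coordinate sending xs to infinity *)

Lemma toC_norm (R : realType) (x : R) : `|toC x| = toC `|x| :> R[i].
Proof. by rewrite normc_def /= expr0n addr0 sqrtr_sqr. Qed.

Lemma horner_toC (R : realType) (p : {poly R}) (x : R) :
  (map_poly toC p).[toC x] = toC p.[x] :> R[i].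
Proof. exact: horner_map. Qed.

(* r(t, xs), with the junk value 0 at t = xs. *)
Definition chart (R : realType) (xs t : option R) : R :=
  match xs, t with
  | None, Some x => x
  | Some a, Some x => (a - x)^-1
  | _, None => 0
  end.

Definition weight (R : realType) (D : seq (option R)) (xs : option R) : {poly R} :=
  \prod_(c <- D | c != xs) ('X - (chart xs c)%:P).

Lemma chart_inj (R : realType) (xs s t : option R) :
  s != xs -> t != xs -> chart xs s = chart xs t -> s = t.
Proof.
case: xs s t => [a|] [x|] [y|] //= sx tx e; last by rewrite e.
- congr Some; apply: (@addrI _ (- a)); apply: oppr_inj.
  by rewrite !opprD !opprK; exact: invr_inj.
- move/eqP: e; rewrite invr_eq0 subr_eq0 => /eqP e.
  by rewrite e eqxx in sx.
- move/esym/eqP: e; rewrite invr_eq0 subr_eq0 => /eqP e.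
  by rewrite e eqxx in tx.
Qed.

Lemma weight_neq0 (R : realType) (D : seq (option R)) (xs t : option R) :
  t != xs -> ((weight D xs).[chart xs t] != 0) = (t \notin D).
Proof.
move=> tx; elim: D => [|c D IH].
  by rewrite /weight big_nil hornerC oner_neq0.
rewrite /weight big_cons -/(weight D xs) inE negb_or; case: (eqVneq c xs) => [->|cx] /=.
  by rewrite tx IH.
rewrite hornerM hornerXsubC mulf_eq0 negb_or IH subr_eq0; congr (~~ _ && _).
by apply/eqP/eqP => [/chart_inj|->] //; apply.
Qed.

Lemma denom_weight_oo (R : realType) (D : seq (option R)) :
  denom D = weight D None.
Proof. by rewrite /weight [RHS]big_mkcond; apply: eq_bigr => -[]. Qed.

(* The last clause is the same identity at x = oo, where the chart vanishes. *)
Lemma denom_weight (R : realType) (D : seq (option R)) (a : R) :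
  exists k : R, [/\ k != 0,
    forall x, x != a -> (denom D).[x] =
      k * (a - x) ^+ size D * (weight D (Some a)).[(a - x)^-1] &
    None \notin D -> (-1) ^+ size D = k * (weight D (Some a)).[0]].
Proof.
elim: D => [|c D [k [k0 kx koo]]].
  exists 1; rewrite oner_neq0 /denom /weight !big_nil.
  by split => // *; rewrite !hornerC !mulr1.
rewrite /denom /weight !big_cons -/(denom D) -/(weight D (Some a)).
case: c => [c|] /=; last first.
  exists k; split=> [//|x xa|]; last by rewrite ?inE.
  have ax : a - x != 0 by rewrite subr_eq0 eq_sym.
  by rewrite mul1r hornerM hornerXsubC subr0 kx // exprS; field.
rewrite (inj_eq (@Some_inj _)); case: eqVneq => [->|ca] /=.
  exists (- k); rewrite oppr_eq0; split => // [x xa|].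
    by rewrite hornerM hornerXsubC kx // exprS; ring.
  by rewrite ?inE /= => /koo kE; rewrite exprS kE; ring.
have ac : a - c != 0 by rewrite subr_eq0 eq_sym.
(* From [x - c = (a - c) (a - x) (1/(a - x) - 1/(a - c))]. *)
exists ((a - c) * k); rewrite mulf_neq0 //; split => // [x xa|].
  have ax : a - x != 0 by rewrite subr_eq0 eq_sym.
  by rewrite !hornerM !hornerXsubC kx // exprS; field; rewrite ac.
by rewrite ?inE /= => /koo kE; rewrite exprS kE hornerM hornerXsubC; field.
Qed.

(** [P] is the numerator of [F] over the weight in the coordinate. Only values and the limit at [xs]
    are recorded, since the extremal problem sees nothing else of [F]. *)
Definition represents (R : realType) (D : seq (option R)) (xs : option R)
    (F : ratfun R) (P : {poly R[i]}) : Prop :=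
  (forall t, t != xs -> t \notin D -> feval_Rbar F t =
     P.[toC (chart xs t)] / toC (weight D xs).[chart xs t]) /\
  has_lim_at F xs (dn D xs) P`_(size D).

(** [N] is the numerator over [denom D] in the original variable. For [xs = oo] it is [P] itself;
    for finite [a] the substitution [w = 1/(a - x)] turns [P] into a homogenization, up to the
    constant relating the two denominators. *)
Lemma represents_of_frac (R : realType) (D : seq (option R)) (xs : option R)
    (F : ratfun R) (N P : {poly R[i]}) (k : R) :
  (size N <= (size D).+1)%N -> (size P <= (size D).+1)%N ->
  rnum F * map_poly toC (denom D) = N * rden F ->
  match xs with
  | None => N = P
  | Some a => [/\ k != 0, (forall x, x != a -> (denom D).[x] =
      k * (a - x) ^+ size D * (weight D (Some a)).[(a - x)^-1]),
    None \notin D -> (-1) ^+ size D = k * (weight D (Some a)).[0] &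
    N = toC k *: homogenize (size D) P 1 ((toC a)%:P - 'X)]
  end ->
  represents D xs F P.
Proof.
move=> sN sP e rel.
have val t : t != xs -> t \notin D -> feval_Rbar F t =
     P.[toC (chart xs t)] / toC (weight D xs).[chart xs t].
  move=> tx tD.
  have w0 : (weight D xs).[chart xs t] != 0 by rewrite weight_neq0.
  case: t tx tD w0 => [x|] tx tD w0.
    have : (map_poly toC (denom D)).[toC x] = toC (denom D).[x] by exact: horner_toC.
    case: xs rel tx w0 => [a [k0 kx _ NE]|NP] /= tx w0 Mx.
      have xa : x != a by [].
      have ax : a - x != 0 by rewrite subr_eq0 eq_sym.
      have [|_ ->] := feval_frac e (z := toC x).
        by rewrite Mx fmorph_eq0 kx // !mulf_neq0 // expf_neq0.
      have vE : ((toC a)%:P - 'X).[toC x] = toC (a - x).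
        by rewrite hornerD hornerN hornerC hornerX rmorphB.
      rewrite NE hornerZ horner_homogenize // vE ?fmorph_eq0 // hornerC.
      rewrite mul1r -fmorphV Mx kx // !rmorphM rmorphXn /=.
      rewrite mulrA -mulf_div divff ?mul1r //.
      by rewrite mulf_neq0 ?expf_neq0 ?fmorph_eq0.
    have [|_ ->] := feval_frac e (z := toC x).
      by rewrite Mx denom_weight_oo fmorph_eq0.
    by rewrite Mx NP denom_weight_oo.
  case: xs rel tx w0 => [a [k0 _ koo NE]|//] tx w0.
  have mM : map_poly toC (denom D) \is monic by rewrite map_monic denom_monic.
  have sM : size (map_poly toC (denom D)) = (size D).+1.
    rewrite size_map_poly -size_denom; have /count_memPn -> : None \notin D by [].
    by rewrite addn0.
  (* At oo the value is [(-1)^n k P_0]; since [k W(0) = (-1)^n] has square 1, this equals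
     [P_0 / W(0)]. *)
  rewrite (feval_oo e mM sM sN) NE coefZ homogenize_top_coef /=.
  have W0 : toC (weight D (Some a)).[0] != 0 :> R[i] by rewrite fmorph_eq0.
  have sgE : (-1) ^+ size D = toC k * toC (weight D (Some a)).[0] :> R[i].
    by rewrite -rmorphM -koo // rmorphXn rmorphN1.
  have := sqrr_sign R[i] (size D); rewrite sgE rmorph0 (horner_coef0 P).
  move: W0; move: (toC k) (toC (weight D (Some a)).[0]) P`_0.
  move=> {k0 NE w0 koo sgE}k w p w0 sq1.
  have -> : k * (k * w * p) = (k * w) ^+ 2 * p / w by field.
  by rewrite sq1 mul1r.
split=> // eps eps0.
(* Each copy of [xs] in [D] contributes a factor [X], so [M(w) = W(w) w^(d_n)] is monic of degree
   exactly [n], and [F / r^(d_n) = P / M] tends to [P_n]. *)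
pose M := \prod_(c <- D) ('X - (if c != xs then chart xs c else 0)%:P).
have ME w : M.[w] = (weight D xs).[w] * w ^+ dn D xs.
  rewrite /dn divval_embC /M /weight; elim: (D) => [|c D' IH].
    by rewrite !big_nil /= !hornerC mulr1.
  rewrite !big_cons /=; case: eqVneq => [->|cx] /=.
    by rewrite hornerM hornerXsubC subr0 IH exprS mulrCA.
  by rewrite !hornerM !hornerXsubC IH add0n mulrA.
have sM : size (map_poly toC M : {poly R[i]}) = (size D).+1.
  by rewrite size_map_poly size_prod_XsubC.
have mM : (map_poly toC M : {poly R[i]}) \is monic.
  by rewrite map_monic monic_prod // => c _; rewrite monicXsubC.
have eps0' : 0 < toC eps :> R[i] by rewrite ltcR.
have [B B0 hB] := ratio_limit sP mM sM eps0'.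
have BE : B = toC (complex.Re B) by rewrite RRe_real // gtr0_real.
move: (complex.Re B) BE B0 hB => {B} b -> b0 hB; rewrite ltcR in b0.
have near x : Some x != xs -> b < `|chart xs (Some x)| ->
    `|feval F (toC x) / toC (chart xs (Some x)) ^+ dn D xs - P`_(size D)| < toC eps.
  move=> xx bx; have [|M0] := hB (toC (chart xs (Some x))).
    by rewrite toC_norm ltcR.
  rewrite horner_toC fmorph_eq0 ME mulf_eq0 negb_or weight_neq0 // in M0.
  case/andP: M0 => xD c0; have /= -> := val _ xx xD.
  by rewrite horner_toC ME rmorphM rmorphXn /= invfM mulrA.
case: xs {val rel M ME mM sM hB} near => [a|] near.
  exists b^-1; split => [|x]; first by rewrite invr_gt0.
  rewrite normr_gt0 subr_eq0 => /andP[xa xb].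
  have -> : rfun (toC x) (Some a) = toC (chart (Some a) (Some x)) :> R[i].
    by rewrite /= div1r -rmorphB fmorphV.
  apply: near => //=; rewrite normfV -[b]invrK distrC ltf_pV2 //.
    by rewrite posrE invr_gt0.
  by rewrite posrE normr_gt0 subr_eq0.
by exists b => x bx; apply: near.
Qed.


(** In characteristic 0 the points [a + 1], [a + 2], ... are distinct and different from [a], which
    gives enough roots of [p - q]. *)
Lemma poly_eq_off_point (K : numFieldType) (p q : {poly K}) (a : K) :
  (forall x, x != a -> p.[x] = q.[x]) -> p = q.
Proof.
move=> pq; apply/subr0_eq.
apply: (@poly_eq0_of_roots _ [seq a + i.+1%:R | i <- iota 0 (size (p - q))]).
- rewrite map_inj_uniq ?iota_uniq // => i j /addrI/eqP.
  by rewrite eqr_nat => /eqP [].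
- by rewrite size_map size_iota.
- move=> _ /mapP[i _ ->]; rewrite hornerD hornerN pq ?subrr //.
  by rewrite -subr_eq0 addrC addKr pnatr_eq0.
Qed.

Lemma in_L_represents (R : realType) (D : seq (option R)) (xs : option R)
    (F : ratfun R) : in_L D F ->
  exists2 P : {poly R[i]}, (size P <= (size D).+1)%N & represents D xs F P.
Proof.
move=> /in_LP[N sN e]; case: xs => [a|]; last first.
  by exists N => //; apply: (represents_of_frac (k := 1) sN).
have [k [k0 kx koo]] := denom_weight D a.
have k0' : toC k != 0 :> R[i] by rewrite fmorph_eq0.
pose n := size D.
(* The inverse of [w = 1/(a - x)] is [x = (a w - 1)/w]. *)
pose P := (toC k)^-1 *: homogenize n N ((toC a) *: 'X - 1) 'X.
have sP : (size P <= n.+1)%N.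
  rewrite (leq_trans (size_scale_leq _ _)) // size_homogenize ?size_polyX //.
  rewrite (leq_trans (size_polyD _ _)) // size_polyN geq_max size_poly1 andbT.
  by rewrite (leq_trans (size_scale_leq _ _)) // size_polyX.
exists P => //; apply: (represents_of_frac (k := k) sN) => //; split => //.
apply: (@poly_eq_off_point _ _ _ (toC a)) => x xa.
have ax : toC a - x != 0 by rewrite subr_eq0 eq_sym.
have vE : ((toC a)%:P - 'X).[x] = toC a - x by rewrite hornerD hornerN hornerC hornerX.
rewrite hornerZ horner_homogenize ?vE // hornerC mul1r hornerZ.
rewrite horner_homogenize ?hornerX ?invr_eq0 //.
have -> : ((toC a *: 'X - 1).[(toC a - x)^-1] / (toC a - x)^-1) = x.
  by rewrite hornerD hornerN hornerZ hornerX hornerC; field.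
rewrite exprVn -/n; move: ((_ - x) ^+ n) (expf_neq0 n ax) => v v0.
by field; apply/andP.
Qed.

(** With the converse above, this lets the competitors be replaced by all polynomials of degree at
    most [n]. *)
Lemma represents_in_L (R : realType) (D : seq (option R)) (xs : option R)
    (P : {poly R[i]}) : (size P <= (size D).+1)%N ->
  exists2 F : ratfun R, in_L D F & represents D xs F P.
Proof.
move=> sP.
have frac (N : {poly R[i]}) : (size N <= (size D).+1)%N ->
    exists2 F : ratfun R, in_L D F &
    rnum F * map_poly toC (denom D) = N * rden F.
  move=> sN; have [|F e] := @ratfun_of_fraction R N (map_poly toC (denom D)).
    by rewrite map_monic denom_monic.
  by exists F => //; apply/in_LP; exists N.
case: xs => [a|]; last first.
  by have [F LF e] := frac P sP; exists F => //; apply: (represents_of_frac (k := 1) sP).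
have [k [k0 kx koo]] := denom_weight D a.
pose N := toC k *: homogenize (size D) P 1 ((toC a)%:P - 'X).
have sN : (size N <= (size D).+1)%N.
  rewrite (leq_trans (size_scale_leq _ _)) // size_homogenize ?size_poly1 //.
  rewrite (leq_trans (size_polyD _ _)) // size_polyN geq_max size_polyX andbT.
  by rewrite (leq_trans (size_polyC_leq1 _)).
have [F LF e] := frac N sN; exists F => //.
by apply: (represents_of_frac (k := k) sN).
Qed.

Lemma has_lim_at_unique (R : realType) (F : ratfun R) xs d l1 l2 :
  has_lim_at F xs d l1 -> has_lim_at F xs d l2 -> l1 = l2.
Proof.
move=> h1 h2; apply/eqP; rewrite -subr_eq0; apply/negPn/negP => l0.
have n0 : 0 < `|l1 - l2| by rewrite normr_gt0.
pose e := complex.Re `|l1 - l2| / 2.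
have nE : `|l1 - l2| = toC (complex.Re `|l1 - l2|) by rewrite RRe_real // gtr0_real.
have e0 : 0 < e.
  by rewrite divr_gt0 // -ltcR -nE.
have close z : `|z - l1| < toC e -> `|z - l2| < toC e -> False.
  move=> z1 z2; have := ler_distD z l1 l2; rewrite [`|l1 - z|]distrC.
  move=> /le_lt_trans/(_ (ltrD z1 z2)).
  by rewrite nE -rmorphD /= -splitr ltxx.
have := h1 e e0; have := h2 e e0; case: xs {h1 h2} => [a|].
  move=> [d2 [d20 h2]] [d1 [d10 h1]].
  pose x := a + Num.min d1 d2 / 2.
  have m0 : 0 < Num.min d1 d2 / 2 by rewrite divr_gt0 // lt_min d10.
  have xa : `|x - a| = Num.min d1 d2 / 2.
    by rewrite /x addrC addKr gtr0_norm.
  have mlt : Num.min d1 d2 / 2 < Num.min d1 d2.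
    by rewrite ltr_pdivrMr // ltr_pMr ?ltr1n // lt_min d10.
  have c1 : 0 < `|x - a| < d1 by rewrite xa m0 (lt_le_trans mlt) // ge_min lexx.
  have c2 : 0 < `|x - a| < d2.
    by rewrite xa m0 (lt_le_trans mlt) // ge_min lexx orbT.
  exact: close (h1 x c1) (h2 x c2).
move=> [M2 h2] [M1 h1]; pose x := 1 + `|M1| + `|M2|.
have xE : `|x| = x by rewrite ger0_norm // !addr_ge0.
have c1 : M1 < `|x|.
  by rewrite xE /x; have := ler_norm M1; have := normr_ge0 M2; lra.
have c2 : M2 < `|x|.
  by rewrite xE /x; have := ler_norm M2; have := normr_ge0 M1; lra.
exact: close (h1 x c1) (h2 x c2).
Qed.

(** * Cyclic order, sign function and compactness *)

(** Two Möbius maps sending [xs] to oo differ by an affine map; determinant 1 makes the slope [c^-2]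
    for finite [xs] and [d^-2] for oo, hence positive. *)
Lemma mobius_chart (R : realType) (a b c d : R) (xs : option R) :
  a * d - b * c = 1 -> mobius a b c d xs = None ->
  exists al be : R, 0 < al /\
    forall t, t != xs -> mobius a b c d t = Some (al * chart xs t + be).
Proof.
case: xs => [e|] det /=; last first.
  case: eqP => // c0 _; rewrite c0 mulr0 subr0 in det.
  have d0 : d != 0.
    apply/eqP => d0; move: det; rewrite d0 mulr0 => /esym/eqP.
    by rewrite oner_eq0.
  have aE : a = d^-1 by apply: (mulIf d0); rewrite det mulVf.
  exists (d^-1 ^+ 2), (b / d); split; first by rewrite exprn_even_gt0 //= invr_eq0.
  move=> [x|] // _ /=; rewrite c0 mul0r add0r (negbTE d0); congr Some.
  by rewrite aE; field.
case: eqP => // ced _.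
have dE : d = - (c * e) by apply/eqP; rewrite -addr_eq0 addrC ced.
have c0 : c != 0.
  apply/eqP => c0; move: det; rewrite dE c0 !(mul0r, mulr0, oppr0, addr0).
  by move/esym/eqP; rewrite oner_eq0.
have det' : - c * (a * e + b) = 1 by rewrite -det dE; ring.
exists (c^-1 ^+ 2), (a / c); split; first by rewrite exprn_even_gt0 //= invr_eq0.
have bE : b = - c^-1 - a * e.
  by apply: (mulfI c0); rewrite mulrBr mulrN mulfV // -det'; ring.
move=> [x|] tx /=; last by rewrite (negbTE c0) mulr0 add0r.
have ex : e - x != 0 by rewrite subr_eq0 eq_sym.
have -> : c * x + d = - (c * (e - x)) by rewrite dE; ring.
rewrite oppr_eq0 mulf_eq0 (negbTE c0) (negbTE ex) /=; congr Some.
by rewrite bE; field; rewrite ex c0.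
Qed.

Lemma mobius_of_chart (R : realType) (xs : option R) :
  exists a b c d : R, [/\ a * d - b * c = 1, mobius a b c d xs = None &
    forall t, t != xs -> mobius a b c d t = Some (chart xs t)].
Proof.
case: xs => [e|].
  exists 0, 1, (-1), e; split => /=; first by ring.
    by rewrite mulN1r addNr eqxx.
  move=> [x|] tx /=; last by rewrite oppr_eq0 oner_eq0 mul0r.
  have ex : e - x != 0 by rewrite subr_eq0 eq_sym.
  by rewrite mulN1r addrC (negbTE ex) mul0r add0r div1r.
exists 1, 0, 0, 1; split => /=; first by ring.
  by rewrite eqxx.
by move=> [x|] // _ /=; rewrite mul0r add0r oner_eq0 mul1r addr0 divr1.
Qed.

Lemma map_off_point (R : realType) (xs : option R) (X : seq (option R))
    (f : option R -> option R) (g : option R -> R) :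
  xs \notin X -> (forall t, t != xs -> f t = Some (g t)) ->
  map f X = map Some (map g X).
Proof.
move=> xX fg; rewrite -map_comp; apply/eq_in_map => t tX /=.
by apply: fg; apply: contraNneq xX => <-.
Qed.

(** Every admissible Möbius map is an increasing affine function of the chart, so it orders the
    points as the chart does; conversely the chart is itself such a map. *)
Lemma cyc_ordered_chart (R : realType) (xs : option R) (X : seq (option R)) :
  cyc_ordered (xs :: X) <->
  [/\ (2 <= size X)%N, xs \notin X &
      sorted (fun x y : R => x < y) (map (chart xs) X)].
Proof.
split=> [[sX [/= /andP[xX _] [a [b [c [d [det [mxs [ys [mys sys]]]]]]]]]]|[sX xX so]].
  split=> //; have [al [be [al0 mE]]] := mobius_chart det mxs.
  have ysE : ys = map (fun t => al * chart xs t + be) X.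
    by apply: (inj_map (@Some_inj _)); rewrite -mys; exact: map_off_point mE.
  move: sys; rewrite ysE !sorted_map; congr sorted => //.
  by apply/funext => s; apply/funext => t; rewrite /= ltrD2r ltr_pM2l.
split=> //; split.
  rewrite /= xX; apply: (@map_uniq _ _ (chart xs)).
  exact: (sorted_uniq lt_trans (@ltxx _ R)) so.
have [a [b [c [d [det mxs mE]]]]] := mobius_of_chart xs.
exists a, b, c, d; do !split => //; exists (map (chart xs) X); split => //.
exact: map_off_point mE.
Qed.

(** Away from [xs] the arc [[xs, c)] becomes the ray left of the coordinate of [c]; weighting
    distinct points by multiplicity amounts to summing over the whole list. *)
Lemma sign_fun_chart (R : realType) (D : seq (option R)) (xs t : option R) :
  t != xs -> sign_fun D xs t =
    (\sum_(c <- D | c != xs) (chart xs t < chart xs c)%R)%N%:Z.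
Proof.
move=> tx; rewrite /sign_fun.
have hE c : c != xs ->
    `[< in_halfopen xs c t >] = (chart xs t < chart xs c).
  move=> cx; apply/asboolP/idP => [[/cyc_ordered_chart[_ _] /=|/eqP]|lt_tc].
  - by rewrite andbT.
  - by rewrite (negbTE tx).
  left; apply/cyc_ordered_chart; split => //=; last by rewrite lt_tc.
  by rewrite !inE negb_or ![xs == _]eq_sym tx.
pose g c := nat_of_bool (chart xs t < chart xs c)%R.
rewrite (eq_bigr (fun c => (iterop (count_mem c D) addn (g c) 0%N)%:Z)); last first.
  move=> c cx; rewrite hE // Monoid.iteropE iter_addn_0 /g mulnC.
  by case: (_ < _); rewrite ?mulr1 ?mulr0 ?muln1 ?muln0.
rewrite -(big_morph Posz PoszD (erefl _)).
by rewrite (@big_undup_iterop_count _ _ addn).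
Qed.

(** The negative factors of the weight are exactly those counted by the sign function. *)
Lemma weight_sign (R : realType) (D : seq (option R)) (xs t : option R) :
  t != xs -> exists S : nat, sign_fun D xs t = S%:Z /\
    (weight D xs).[chart xs t] = (-1) ^+ S * `|(weight D xs).[chart xs t]|.
Proof.
move=> tx; eexists; split; first exact: sign_fun_chart.
rewrite /weight horner_prod.
elim: D => [|c D IH]; first by rewrite !big_nil normr1 mulr1.
rewrite !big_cons; case: ifP => // _; rewrite normrM exprD.
rewrite {1}IH hornerXsubC mulrACA; congr (_ * _).
case: ltP => h; first by rewrite expr1 ltr0_norm ?subr_lt0 // mulN1r opprK.
by rewrite expr0 mul1r ger0_norm // subr_ge0.
Qed.

(** On the circle the chart is a quotient of two affine functions whose denominator vanishes nowhere
    on the image of [E], so the set in question is a continuous image of a compact set. *)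
Lemma compact_chart (R : realType) (E : set (option R)) (xs : option R) :
  compact_Rbar E -> ~ E xs -> compact (chart xs @` E).
Proof.
move=> cE Exs.
have one2 (x : R) : 1 + x ^+ 2 != 0 by rewrite gt_eqF // ltr_pwDl ?sqr_ge0.
have [num [den [cnum cden gE]]] : exists num den : R * R -> R,
    [/\ continuous num, continuous den & forall t, t != xs ->
      den (stereo t) != 0 /\ num (stereo t) / den (stereo t) = chart xs t].
  have cfst : continuous (fun z : R * R => z.1) by move=> z; exact: cvg_fst.
  have csnd : continuous (fun z : R * R => z.2) by move=> z; exact: cvg_snd.
  have ccst (k : R) : continuous (fun z : R * R => k) by move=> z; exact: cvg_cst.
  case: xs {Exs} => [a|].
    (* At the image of a real [x] the two functions are [2 (a - x) / (1 + x^2)] and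
       [2 (a - x)^2 / (1 + x^2)]. *)
    exists (fun z => a * (1 - z.2) - z.1).
    exists (fun z => (1 + a ^+ 2) - 2 * a * z.1 - (a ^+ 2 - 1) * z.2).
    split.
    - move=> z; apply: cvgB; last exact: cfst.
      by apply: cvgM; [exact: ccst|apply: cvgB; [exact: ccst|exact: csnd]].
    - move=> z; apply: cvgB; last by apply: cvgM; [exact: ccst|exact: csnd].
      by apply: cvgB; [exact: ccst|apply: cvgM; [exact: ccst|exact: cfst]].
    move=> [x|] tx /=; last first.
      have -> : 1 + a ^+ 2 - 2 * a * 0 - (a ^+ 2 - 1) * 1 = 2 by ring.
      by split; [|rewrite subrr mulr0 subr0 mul0r].
    have ax : a - x != 0 by rewrite subr_eq0 eq_sym.
    have -> : 1 + a ^+ 2 - 2 * a * (2 * x / (1 + x ^+ 2)) -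
        (a ^+ 2 - 1) * ((x ^+ 2 - 1) / (1 + x ^+ 2)) =
        2 * (a - x) ^+ 2 / (1 + x ^+ 2) by field.
    split; first by rewrite !mulf_neq0 ?invr_eq0 ?expf_neq0 ?pnatr_eq0.
    by field; rewrite ax one2.
  exists (fun z => z.1), (fun z => 1 - z.2); split => //.
    by move=> z; apply: cvgB; [exact: ccst|exact: csnd].
  move=> [x|] // _ /=.
  have -> : 1 - (x ^+ 2 - 1) / (1 + x ^+ 2) = 2 / (1 + x ^+ 2) by field.
  split; first by rewrite mulf_neq0 ?invr_eq0 ?pnatr_eq0.
  by field.
have neq t : E t -> t != xs by move=> Et; apply: contra_notN Exs => /eqP <-.
have -> : chart xs @` E = (fun z => num z / den z) @` (stereo @` E).
  rewrite image_comp; apply/seteqP; split => [_ [t Et <-]|_ [t Et <-]];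
    by exists t => //=; have [_ ->] := gE t (neq t Et).
apply: continuous_compact cE; apply: continuous_in_subspaceT => z /set_mem[t Et <-].
have [d0 _] := gE t (neq t Et).
by apply: cvgM; [exact: cnum|apply: cvgV => //; exact: cden].
Qed.

(** * The extremal problem in the coordinate *)

Lemma infinite_points (R : realType) (E : set (option R)) m :
  ~ finite_set E ->
  exists s : seq R, [/\ uniq s, size s = m & forall x, x \in s -> E (Some x)].
Proof.
move=> infE; elim: m => [|m [s [us ss Es]]]; first by exists [::].
have [x Ex xs] : exists2 x, E (Some x) & x \notin s.
  apply: contrapT => nx; apply: infE.
  apply: (@sub_finite_set _ _ [set` None :: map Some s]); last exact: finite_seq.
  move=> [x|] Et /=; last by rewrite inE.
  rewrite inE (mem_map (@Some_inj _)) /=; apply: contrapT => /negP xs.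
  by apply: nx; exists x.
exists (x :: s); split => /=; first by rewrite xs.
  by rewrite ss.
by move=> y; rewrite inE => /predU1P[-> //|/Es].
Qed.

Lemma infinite_chart_points (R : realType) (E : set (option R)) xs m :
  ~ finite_set E -> ~ E xs ->
  exists s : seq R, [/\ uniq s, size s = m & forall w, w \in s ->
     exists2 x, E (Some x) & w = chart xs (Some x)].
Proof.
move=> infE Exs; have [s [us ss Es]] := infinite_points m infE.
exists (map (fun x => chart xs (Some x)) s); split.
- rewrite map_inj_in_uniq // => x y /Es Ex /Es Ey /chart_inj e.
  suff [] : Some x = Some y by [].
  by apply: e; apply/eqP => e; apply: Exs; rewrite -e.
- by rewrite size_map.
- by move=> _ /mapP[x /Es Ex ->]; exists x.
Qed.

(** * Real parts of complex polynomials at real points *)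

Lemma Re_mulr_toC (R : realType) (z : R[i]) (x : R) :
  complex.Re (z * toC x) = complex.Re z * x.
Proof. by case: z => u v /=; rewrite mulr0 subr0. Qed.

Definition re_poly (R : realType) (P : {poly R[i]}) : {poly R} :=
  \poly_(i < size P) complex.Re P`_i.

Lemma size_re_poly (R : realType) (P : {poly R[i]}) :
  (size (re_poly P) <= size P)%N.
Proof. exact: size_poly. Qed.

Lemma coef_re_poly (R : realType) (P : {poly R[i]}) i :
  (re_poly P)`_i = complex.Re P`_i.
Proof. by rewrite coef_poly; case: ltnP => // ?; rewrite nth_default. Qed.

Lemma horner_re_poly (R : realType) (P : {poly R[i]}) (x : R) :
  (re_poly P).[x] = complex.Re P.[toC x].
Proof.
rewrite horner_poly horner_coef.
rewrite (big_morph (@complex.Re R) (id1 := 0) (op1 := +%R)) //; last by case=> ? ? [].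
by apply: eq_bigr => i _; rewrite -rmorphXn Re_mulr_toC.
Qed.

Lemma norm_Re_le (R : realType) (z : R[i]) (b : R) :
  `|z| <= toC b -> `|complex.Re z| <= b.
Proof. by move=> zb; rewrite -lecR (le_trans (normc_ge_Re z)). Qed.

(** Forces a complex competitor to be real at nodes where its real part attains the bound. *)
Lemma norm_Re_eq (R : realType) (z : R[i]) :
  `|z| <= toC `|complex.Re z| -> z = toC (complex.Re z).
Proof.
move=> zr; apply/eqP; rewrite eq_complex /= eqxx /=.
have := add_Re2_Im2 z; set r := complex.Re z in zr *; set v := complex.Im z => e.
have : `|z| ^+ 2 <= toC `|r| ^+ 2 by rewrite ler_pXn2r ?nnegrE // ler0c.
rewrite -e -rmorphXn lecR real_normK ?num_real // gerDl => v0.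
by rewrite -sqrf_eq0 eq_le v0 sqr_ge0.
Qed.

Lemma poly_real_at_points (R : realType) (P : {poly R[i]}) (s : seq R) :
  uniq s -> (size P <= size s)%N ->
  (forall w, w \in s -> P.[toC w] = toC (complex.Re P.[toC w])) ->
  P = map_poly toC (re_poly P).
Proof.
move=> us sP re; apply/subr0_eq.
apply: (@poly_eq0_of_roots _ [seq toC w : R[i] | w <- s]).
- by rewrite map_inj_uniq //; exact: complexI.
- rewrite size_map (leq_trans (size_polyD _ _)) // size_polyN geq_max sP.
  by rewrite size_map_poly (leq_trans (size_re_poly _)).
- move=> _ /mapP[w /re Pw ->].
  by rewrite hornerD hornerN horner_toC horner_re_poly -Pw subrr.
Qed.

(** The offset [k] carries the starting sign through the induction; the sets for [k] and [k + 2]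
    coincide, so passing to the tail just swaps the two sets. *)
Lemma alternatingP (R : realType) (K : set R) (f g : R -> R) (s : seq R) (k : nat) :
  (forall i, (i < size s)%N -> K s`_i /\ f s`_i = (-1) ^+ (k + i) * g s`_i) <->
  alternating (K `&` [set x | f x = (-1) ^+ k * g x])
              (K `&` [set x | f x = (-1) ^+ k.+1 * g x]) s.
Proof.
elim: s k => [|a s IH] k //=.
have -> : (K `&` [set x | f x = (-1) ^+ k * g x]) =
          (K `&` [set x | f x = (-1) ^+ k.+2 * g x]).
  by congr (_ `&` _); apply/seteqP; split => x /= ->; rewrite !exprS !mulN1r opprK.
rewrite -IH; split=> [H|[[Ka fa] H] [|i] /= si].
- split.
    have [] := H 0%N isT; rewrite /= addn0 => Ka fa.
    by split; rewrite //= !exprS !mulN1r opprK.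
  by move=> i si; have := H i.+1 si; rewrite /= addSnnS.
- by rewrite addn0; split => //; move: fa; rewrite /= !exprS !mulN1r opprK.
- by rewrite -addSnnS; exact: H.
Qed.

(** * Extremality and alternation expressed by numerators *)

Section Extremal.
Variables (R : realType) (E : set (option R)) (D : seq (option R)) (xs : option R).
Hypotheses (ED : forall c, c \in D -> ~ E c) (Exs : ~ E xs).

Let K := chart xs @` E.
Let W := weight D xs.
Let n := size D.

Definition bounded_on_chart (P : {poly R[i]}) :=
  forall w, K w -> `|P.[toC w]| <= toC `|W.[w]|.

Lemma E_neq t : E t -> t != xs.
Proof. by move=> Et; apply: contra_notN Exs => /eqP <-. Qed.

Lemma E_notin t : E t -> t \notin D.
Proof. by move=> Et; apply/negP => /ED. Qed.

Lemma weight_chart_neq0 w : K w -> W.[w] != 0.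
Proof. by move=> [t Et <-]; rewrite weight_neq0 ?E_neq ?E_notin. Qed.

Lemma supnorm_chart F P : represents D xs F P ->
  supnorm_le1 E F <-> bounded_on_chart P.
Proof.
move=> [val _]; have nE t : E t ->
    (`|feval_Rbar F t| <= 1) = (`|P.[toC (chart xs t)]| <= toC `|W.[chart xs t]|).
  move=> Et; rewrite val ?E_neq ?E_notin // normf_div toC_norm ler_pdivrMr ?mul1r //.
  by rewrite ltcR normr_gt0 weight_chart_neq0 //; exists t.
split=> [H w [t Et <-]|H t Et]; first by rewrite -nE // H.
by rewrite nE // H //; exists t.
Qed.

(** Competitors are exchanged for their numerators. The set under [sup] is nonempty because of [F],
    and bounded by the Lagrange estimate at [n + 1] points, available because [E] is infinite. *)
Lemma extremal_chart F P : ~ finite_set E -> compact_Rbar E ->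
  in_L D F -> supnorm_le1 E F -> represents D xs F P ->
  extremal E D xs F <->
  forall P' : {poly R[i]}, (size P' <= n.+1)%N -> bounded_on_chart P' ->
    complex.Re P'`_n <= complex.Re P`_n.
Proof.
move=> infE cE LF F1 rF; rewrite /extremal /m_n; set S := (X in sup X).
have SE y : S y <-> exists P' : {poly R[i]},
  [/\ (size P' <= n.+1)%N, bounded_on_chart P' &
    y = complex.Re P'`_n].
  split=> [[l [G [[LG G1] Gl]] <-]|[P' [sP' bP' ->]]].
    have [P' sP' rG] := in_L_represents xs LG.
    exists P'; split => //; first by apply/(supnorm_chart rG).
    by have [_ /(has_lim_at_unique Gl) ->] := rG.
  have [G LG rG] := represents_in_L xs sP'.
  exists P'`_n => //; exists G; split; last by case: rG.
  by split => //; apply/(supnorm_chart rG).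
have ubS : has_ubound S.
  have [s [us ss Ks]] := infinite_chart_points n.+1 infE Exs.
  exists (\sum_(x <- s) `|W.[x]| / `|\prod_(y <- s | y != x) (x - y)|).
  move=> y /SE[P' [sP' bP' ->]]; rewrite -coef_re_poly.
  have -> : n = (size s).-1 by rewrite ss.
  apply: top_coef_bound => //; first by rewrite ss (leq_trans (size_re_poly _)).
  move=> x /Ks[t Et xE]; rewrite horner_re_poly; apply: norm_Re_le.
  by apply: bP'; exists (Some t).
have SP : (size P <= n.+1)%N -> S (complex.Re P`_n).
  by move=> sP; apply/SE; exists P; split => //; apply/(supnorm_chart rF).
have SF : S (complex.Re P`_n).
  by exists P`_n => //; exists F; split => //; case: rF.
split=> [[_ [l [Fl lE]]] P' sP' bP'|max].
  have [_ /(has_lim_at_unique Fl) <-] := rF; rewrite lE.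
  by apply: ub_le_sup => //; apply/SE; exists P'.
split=> //; exists P`_n; split; first by case: rF.
apply/eqP; rewrite eq_le ub_le_sup //=; apply: ge_sup; first by eexists; exact: SF.
by move=> y /SE[P' [sP' bP' ->]]; exact: max.
Qed.

(** Multiplying [F = p / W] by [W], whose sign is [(-1)^S_n], removes the sign function from the
    exponent. *)
Lemma value_sign F p t (i : nat) : represents D xs F (map_poly toC p) -> E t ->
  feval_Rbar F t = (-1) ^ (i%:Z - sign_fun D xs t) <->
  p.[chart xs t] = (-1) ^+ i * `|W.[chart xs t]|.
Proof.
move=> [val _] Et; have tx := E_neq Et.
have [S [-> WS]] := weight_sign D tx.
have W0 : W.[chart xs t] != 0 by apply: weight_chart_neq0; exists t.
rewrite val ?E_notin // horner_toC -/W.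
have -> : (-1) ^ (i%:Z - S%:Z) = toC ((-1) ^+ i * (-1) ^+ S) :> R[i].
  rewrite expfzDr ?oppr_eq0 ?oner_eq0 // -invr_expz.
  by rewrite rmorphM !rmorphXn !rmorphN1 -signr_odd invr_sign signr_odd.
rewrite -fmorph_div; set w := chart xs t in W0 WS *; set N := `|_| in WS *.
have NE : (-1) ^+ S * W.[w] = N by rewrite WS signrMK.
split=> [/complexI e|->].
  by rewrite -NE mulrA -e divfK.
suff -> : (-1) ^+ i * N / W.[w] = (-1) ^+ i * (-1) ^+ S by [].
by apply: (mulIf W0); rewrite divfK // -mulrA NE.
Qed.

(** Cyclic order lists the points from left to right, the signs are counted from the right, whence
    the reversal. The bound [0 < m] provides the two points that a cyclic order requires after
    [xs]. *)
Lemma alternation_chart F p m : represents D xs F (map_poly toC p) -> (0 < m)%N ->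
  (exists X, alternation_set E D xs F X /\ size X = m.+1) <->
  exists s, [/\ size s = m.+1, decreasing s &
    forall i, (i < size s)%N -> K s`_i /\ p.[s`_i] = (-1) ^+ i * `|W.[s`_i]|].
Proof.
move=> rF m0; split=> [[X [[XE [uX [cX altX]]] sX]]|[s [ss ds alts]]].
  have [_ xX so] := (cyc_ordered_chart xs X).1 cX.
  exists (rev (map (chart xs) X)); rewrite size_rev size_map sX; split => //.
    by rewrite /decreasing rev_sorted.
  (* Position [i] in the reversed list is position [m - i] in [X], and [(m + 1) - (m - i + 1) = i]
     is the exponent. *)
  move=> i im; rewrite nth_rev size_map sX //; rewrite subSS.
  have im' : (m - i < size X)%N by rewrite sX ltnS leq_subr.
  rewrite (nth_map None) //; have Ei := XE _ (mem_nth None im').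
  split; first by eexists; [exact: Ei|].
  apply/(value_sign _ rF Ei); rewrite altX // sX.
  have -> : m.+1%:Z - (m - i).+1%:Z = i%:Z; last by [].
  by rewrite subzn ?subSS ?subKn // ltnS leq_subr.
have pre w : exists t, w \in s -> E t /\ chart xs t = w.
  case: (boolP (w \in s)) => [ws|_]; last by exists None.
  have wi : (index w s < size s)%N by rewrite index_mem.
  by have [[t Et te] _] := alts _ wi; exists t; rewrite te nth_index.
have [h hP] := choice pre.
pose X := map h (rev s).
have chX : map (chart xs) X = rev s.
  rewrite -map_comp -[RHS]map_id; apply/eq_in_map => w; rewrite mem_rev /=.
  by case/hP.
have XE t : t \in X -> E t by case/mapP => w; rewrite mem_rev => /hP[Et _] ->.
have sX : size X = m.+1 by rewrite size_map size_rev.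
exists X; split => //; split => //; split.
  by apply: (@map_uniq _ _ (chart xs)); rewrite chX rev_uniq decreasing_uniq.
split.
  apply/cyc_ordered_chart; rewrite sX chX; split => //.
    by apply/negP => /XE.
  by rewrite rev_sorted.
move=> j jX; have Ej := XE _ (mem_nth None jX); rewrite sX in jX *.
have -> : m.+1%:Z - j.+1%:Z = (m - j)%N%:Z by rewrite subzn // subSS.
apply/(value_sign _ rF Ej); rewrite -(nth_map None 0) ?sX //.
rewrite chX nth_rev ss // subSS.
by have [|_ ->] := alts (m - j)%N; rewrite ?ss ?ltnS ?leq_subr.
Qed.

(** If the top coefficient of [Re P'] reaches that of [p], the difference [p - Re P'] satisfies the
    alternation criterion and vanishes. Then [|Re P'| = |W|] at the nodes leaves no room for an
    imaginary part there, and [n + 1] real values make [P'] real. *)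
Lemma alternation_max (p : {poly R}) (P' : {poly R[i]}) s :
  size s = n.+1 -> decreasing s -> (size p <= n.+1)%N -> (size P' <= n.+1)%N ->
  (forall i, (i < size s)%N -> K s`_i /\ p.[s`_i] = (-1) ^+ i * `|W.[s`_i]|) ->
  bounded_on_chart P' ->
  complex.Re P'`_n <= p`_n /\
  (p`_n <= complex.Re P'`_n -> P' = map_poly toC p).
Proof.
move=> ss ds sp sP' alts bP'.
have key : p`_n <= complex.Re P'`_n -> re_poly P' = p.
  move=> le_n; apply/esym/subr0_eq; apply: (alternating_poly_eq0 ds).
  - rewrite ss (leq_trans (size_polyD _ _)) // size_polyN geq_max sp.
    by rewrite (leq_trans (size_re_poly _)).
  - by rewrite ss /= coefB coef_re_poly subr_le0.
  move=> i si; have [Ki pi] := alts i si.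
  rewrite hornerD hornerN mulrBr pi signrMK subr_ge0 horner_re_poly.
  have := norm_Re_le (bP' _ Ki); apply: le_trans.
  by apply: (le_trans (ler_norm _)); rewrite normrM normr_sign mul1r.
split.
  have [//|lt_n] := leP (complex.Re P'`_n) p`_n.
  by have := lt_n; rewrite -(key (ltW lt_n)) coef_re_poly ltxx.
move=> /key pE; rewrite -pE; apply: (@poly_real_at_points _ _ s).
- exact: decreasing_uniq.
- by rewrite ss.
move=> w /(nthP 0)[i si <-]; have [Ki pi] := alts i si.
apply: norm_Re_eq; apply: (le_trans (bP' _ Ki)).
by rewrite -horner_re_poly pE pi normrM normr_sign mul1r normr_id.
Qed.

(** The cross-multiplied difference vanishes at more points of [E] than its degree allows. *)
Lemma in_L_eq F G : ~ finite_set E -> in_L D F -> in_L D G ->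
  (forall t, E t -> feval_Rbar F t = feval_Rbar G t) -> F = G.
Proof.
move=> infE LF LG FG; apply: ratfun_cross_eq; apply/subr0_eq.
set d := _ - _; have [s [us ss Es]] := infinite_points (size d) infE.
apply: (@poly_eq0_of_roots _ [seq toC w : R[i] | w <- s]).
- by rewrite map_inj_uniq //; exact: complexI.
- by rewrite size_map ss.
move=> _ /mapP[x /Es Ex ->].
have den0 (H : ratfun R) : in_L D H -> (rden H).[toC x] != 0.
  move=> /in_LP[N _ e]; have [|//] := feval_frac (z := toC x) e.
  rewrite horner_toC fmorph_eq0; have := E_notin Ex.
  rewrite denom_weight_oo -(@weight_neq0 _ D None) //.
have /= /eqP := FG _ Ex; rewrite /feval eqr_div ?den0 // => /eqP e.
by rewrite hornerD hornerN !hornerM e subrr.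
Qed.

(** At real points of [E] both [F] and the weight are real, so [P] is real at [n + 1] real nodes,
    which determine it. *)
Lemma represents_real F (P : {poly R[i]}) : ~ finite_set E -> is_real_fun F ->
  (size P <= n.+1)%N -> represents D xs F P -> P = map_poly toC (re_poly P).
Proof.
move=> infE rF sP [val _].
have [s [us ss Ks]] := infinite_chart_points n.+1 infE Exs.
apply: (poly_real_at_points us); first by rewrite ss.
move=> w /Ks[x Ex ->]; rewrite RRe_real //.
have fE : feval F (toC x) = P.[toC (chart xs (Some x))] / toC W.[chart xs (Some x)].
  exact: val _ (E_neq Ex) (E_notin Ex).
have W0 : toC W.[chart xs (Some x)] != 0 :> R[i].
  by rewrite fmorph_eq0 weight_chart_neq0 //; exists (Some x).
have -> : P.[toC (chart xs (Some x))] = feval F (toC x) * toC W.[chart xs (Some x)].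
  by rewrite fE divfK.
have toCr (y : R) : (toC y : R[i]) \is Num.real by apply/complex_realP; exists y.
rewrite realM //; have := rF (toC x).
by rewrite (conj_Creal (toCr x)) CrealE => <-.
Qed.

End Extremal.

Theorem mainTheorem1 (R : realType) (E : set (option R)) (n : nat)
    (D : seq (option R)) (xs : option R) (F : ratfun R) :
  compact_Rbar E -> (exists t, ~ E t) -> ~ finite_set E ->
  (1 <= n)%N -> size D = n -> (forall c, c \in D -> ~ E c) -> ~ E xs ->
  is_real_fun F -> in_L D F -> supnorm_le1 E F ->
  (extremal E D xs F <->
     exists X, alternation_set E D xs F X /\ size X = n.+1) /\
  (extremal E D xs F -> forall G, extremal E D xs G -> G = F).
Proof.
move=> cE _ infE n0 sD ED Exs realF LF F1; subst n.
have [P sP rF] := in_L_represents xs LF.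
have PE := represents_real ED Exs infE realF sP rF.
pose p := re_poly P; rewrite -/p in PE.
have sp : (size p <= (size D).+1)%N by rewrite (leq_trans (size_re_poly _)).
have pn : complex.Re P`_(size D) = p`_(size D) by rewrite coef_re_poly.
have bP : bounded_on_chart E D xs P by apply/(supnorm_chart ED Exs rF).
have rp : represents D xs F (map_poly toC p) by rewrite -PE.
have extF := extremal_chart ED Exs infE cE LF F1 rF.
have altF := alternation_chart ED Exs rp n0.
have ext_alt : extremal E D xs F ->
    exists X, alternation_set E D xs F X /\ size X = (size D).+1.
  move=> /extF max; apply/altF; apply: contrapT => noalt.
  (* Without alternation there would be a polynomial below the weight with larger top coefficient,
     contradicting extremality. *)
  have [||||s ss ds alts|p2 [sp2 lt_p2 bp2]] :=
      @larger_top_coef R (chart xs @` E) p (weight D xs) (size D).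
  - exact: compact_chart.
  - exact: sp.
  - by move=> w; exact: weight_chart_neq0.
  - by move=> w Kw; rewrite horner_re_poly; apply: norm_Re_le; exact: bP.
  - apply: noalt; exists s; split => //.
    apply/(alternatingP _ (horner p) (fun w => `|(weight D xs).[w]|) s 0).
    apply: sub_alternating alts => w _ [Kw /= ->]; split => //=.
      by rewrite expr0 mul1r.
    by rewrite expr1 mulN1r.
  have := max (map_poly toC p2).
  rewrite size_map_poly coef_map /= pn leNgt lt_p2 => /(_ sp2) {}max.
  suff : false by [].
  apply: max => w Kw; rewrite horner_toC toC_norm lecR; exact: bp2.
split.
  split=> // /altF[s [ss ds alts]]; apply/extF => P' sP' bP'; rewrite pn.
  by have [] := alternation_max ss ds sp sP' alts bP'.
move=> eF G eG; have /altF[s [ss ds alts]] := ext_alt eF.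
have [[LG G1] _] := eG.
have [P' sP' rG] := in_L_represents xs LG.
have bP' : bounded_on_chart E D xs P' by apply/(supnorm_chart ED Exs rG).
have extG := (extremal_chart ED Exs infE cE LG G1 rG).1 eG.
have [_ uniqP] := alternation_max ss ds sp sP' alts bP'.
(* Extremality of [G], tested against the numerator of [F], gives the inequality of top coefficients
   that triggers the equality case. *)
have P'E : P' = map_poly toC p by apply: uniqP; rewrite -pn; exact: extG.
apply: (in_L_eq ED infE LG LF) => t Et.
by rewrite rG.1 ?rp.1 ?P'E ?(E_neq Exs) ?(E_notin ED).
Qed.
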